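(* $f(4) \leq 21$. That is, every $2$-edge connected graph of diameter $4$ has a strong orientation of diameter at most $21$.
   Context: An orientation of an undirected graph $G$ assigns exactly one direction to each edge. The diameter of a directed graph is the maximum, over ordered pairs of vertices $(u,v)$, of the length of a shortest directed path from $u$ to $v$. The oriented diameter of $G$ is the minimum diameter over all orientations of $G$. $f(d)$ denotes the maximum oriented diameter over all $2$-edge connected (connected and bridgeless) graphs of diameter $d$. *)

(* Defs.v *)
From mathcomp Require Import all_boot.

Set Implicit Arguments.
Unset Strict Implicit.
Unset Printing Implicit Defensive.

(* Finite simple undirected graphs. *)
Record sgraph := SGraph {
  vertex :> finType;
  adj : rel vertex;
  adj_sym : symmetric adj;
  adj_irrefl : irreflexive adj }.

(* A relation [r] is read as a digraph with arcs x -> y when [r x y]; an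
   undirected graph is the digraph of its symmetric relation [adj]. *)
Section Digraph.

Variables (T : finType) (r : rel T).
Implicit Types (x y : T) (p : seq T).

(* The path has vertices x :: p, hence length [size p]. *)
Definition dipath x y p : bool :=
  [&& path r x p, last x p == y & uniq (x :: p)].

(* Distances and diameters are relations to nat: an infinite distance or
   diameter is related to no number. *)
Definition is_dist x y (k : nat) : Prop :=
  (exists2 p, dipath x y p & size p = k) /\
  (forall p, dipath x y p -> k <= size p).

Definition is_diameter (d : nat) : Prop :=
  (exists x y, is_dist x y d) /\
  (forall x y, exists2 k, is_dist x y k & k <= d).

Definition strongly_connected : Prop := forall x y, connect r x y.

End Digraph.

Section Graph.

Variable G : sgraph.

Definition del_edge (x y : G) : rel G :=
  [rel u v | adj u v && ([set u; v] != [set x; y])].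

(* [n_comp r predT] is the number of connected components. *)
Definition bridge (x y : G) : bool :=
  adj x y && (n_comp (@adj G) predT < n_comp (del_edge x y) predT).

Definition two_edge_connected : Prop :=
  strongly_connected (@adj G) /\ (forall x y : G, ~~ bridge x y).

Definition orientation (o : rel G) : Prop :=
  (forall x y, o x y -> adj x y) /\
  (forall x y, adj x y -> o x y (+) o y x).

(* Orientations of infinite diameter do not affect the minimum; if all are
   such, the oriented diameter is infinite and is related to no number. *)
Definition is_oriented_diameter (k : nat) : Prop :=
  (exists2 o, orientation o & is_diameter o k) /\
  (forall o j, orientation o -> is_diameter o j -> k <= j).

End Graph.

(* f(d) = m; every graph in the range of the maximum is required to have a
   finite oriented diameter. *)
Definition is_f (d m : nat) : Prop :=
  (exists G : sgraph, [/\ two_edge_connected G, is_diameter (@adj G) d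
                        & is_oriented_diameter G m]) /\
  (forall G : sgraph, two_edge_connected G -> is_diameter (@adj G) d ->
     exists2 k, is_oriented_diameter G k & k <= m).

(* Main.v *)
Require Import Defs.
From mathcomp Require Import all_boot zify.
From Stdlib Require Import Classical.

(** Grow a set [D] of vertices together with an orientation of some edges inside
    [D] and weights [a], [b] such that any [x], [y] in [D] are joined by a
    directed walk of length at most [b x + a y + 1]; it is enough to reach all
    vertices with weights at most 10, since 10 + 10 + 1 = 21.  The set grows by
    ears: every outside vertex next to [D] chooses a tree rooted at a neighbour
    of [D], the trees are coloured by a maximum cut, and edges are directed away
    from [D] in the trees of one colour, towards [D] in the others, and from the
    first colour to the second.  If the ears have length at most 3, 4 or 5, a
    layer of vertices is added and the weights increase by 2, 3 or 4.

    If all edges lie in triangles, start from one vertex and add four layers.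
    Otherwise choose an edge [p q] in no triangle and, if possible, in no
    4-cycle; rank the vertices by their distances to [p] and [q], direct edges
    along increasing rank, except that [p q] is directed from [q] to [p], and
    start from the vertices on short directed walks from [p] to [q]. *)

Set Implicit Arguments.
Unset Strict Implicit.
Unset Printing Implicit Defensive.

(** * Walks of given length and distances *)

Section Walks.

Variable T : finType.
Implicit Types (r : rel T) (x y z : T) (k : nat).

Fixpoint walk r k x y : bool :=
  if k is j.+1 then [exists z, r x z && walk r j z y] else x == y.

Lemma walk_cons r k x y z : r x y -> walk r k y z -> walk r k.+1 x z.
Proof. by move=> rxy w; apply/existsP; exists y; rewrite rxy. Qed.

Lemma walk1 r x y : r x y -> walk r 1 x y.
Proof. by move=> rxy; apply: walk_cons rxy _ => /=. Qed.

Lemma walk_cat r i j x y z : walk r i x y -> walk r j y z -> walk r (i + j) x z.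
Proof.
elim: i x => [|i IHi] x /=; first by move/eqP->.
case/existsP=> t /andP[rxt wty] wyz.
exact: walk_cons rxt (IHi _ wty wyz).
Qed.

Lemma walk_rcons r k x y z : walk r k x y -> r y z -> walk r k.+1 x z.
Proof. by move=> w ryz; rewrite -addn1; apply: walk_cat w (walk1 ryz). Qed.

Lemma walk_split r i j x z :
  walk r (i + j) x z -> exists2 y, walk r i x y & walk r j y z.
Proof.
elim: i x => [|i IHi] x /=; first by exists x.
case/existsP=> t /andP[rxt /IHi[y wty wyz]].
by exists y => //; apply/existsP; exists t; rewrite rxt.
Qed.

Lemma walk_sub r r' k x y : subrel r r' -> walk r k x y -> walk r' k x y.
Proof.
move=> sr; elim: k x => //= k IHk x /existsP[t /andP[rxt w]].
by apply/existsP; exists t; rewrite sr //= IHk.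
Qed.

Lemma walkP r k x y :
  reflect (exists p, [/\ path r x p, last x p = y & size p = k]) (walk r k x y).
Proof.
elim: k x => [|k IHk] x /=.
  by apply: (iffP eqP) => [->|[[|t p] [] //=]]; exists [::].
apply: (iffP existsP) => [[t /andP[rxt /IHk[p [pp lp sp]]]]|].
  by exists (t :: p); rewrite /= rxt sp.
case=> -[|t p] [] //= /andP[rxt pp] lp [sp].
by exists t; rewrite rxt; apply/IHk; exists p.
Qed.

Lemma walk_sym r k x y : symmetric r -> walk r k x y -> walk r k y x.
Proof.
move=> rs; elim: k x => [|k IHk] x /=; first by rewrite eq_sym.
by case/existsP=> t /andP[rxt /IHk w]; apply: walk_rcons w _; rewrite rs.
Qed.

Lemma walk_connect r k x y : walk r k x y -> connect r x y.
Proof. by case/walkP=> p [pp <- _]; apply/connectP; exists p. Qed.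

Lemma walk_dipath r k x y :
  walk r k x y -> exists2 p, dipath r x y p & size p <= k.
Proof.
case/walkP=> p [pp lp <-]; case/shortenP: pp lp => p' pp' up' sp' lp'.
exists p'; first by rewrite /dipath pp' lp' eqxx.
by apply: uniq_leq_size sp'; case/andP: up'.
Qed.

Lemma dipath_walk r x y p : dipath r x y p -> walk r (size p) x y.
Proof. by case/and3P=> pp /eqP lp _; apply/walkP; exists p. Qed.

Lemma walk_restrict r (X : {set T}) k x y : walk r k x y ->
  (forall i j t, i + j = k -> walk r i x t -> walk r j t y -> t \in X) ->
  walk [rel u v | [&& r u v, u \in X & v \in X]] k x y.
Proof.
elim: k x => //= k IHk x /existsP[t /andP[rxt w]] all.
apply/existsP; exists t; rewrite rxt (all 0 k.+1) //=; last first.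
  by apply/existsP; exists t; rewrite rxt.
rewrite (all 1 k) //=; last by apply/existsP; exists t; rewrite rxt /=.
apply: IHk => // i j s ij wts; apply: (all i.+1 j); first by rewrite -ij.
exact: walk_cons rxt wts.
Qed.

(** Trying lengths below [#|T|] suffices, as walks shorten to simple paths; the value is [#|T|] when
    there is no walk. *)
Definition dist r x y : nat := find (fun k => walk r k x y) (iota 0 #|T|).

Lemma dist_le r k x y : walk r k x y -> dist r x y <= k.
Proof.
move=> w; have [ltk|lek] := ltnP k #|T|.
  rewrite leqNgt; apply/negP=> /(before_find 0).
  by rewrite nth_iota // add0n w.
by apply: leq_trans lek; rewrite -[leqRHS](size_iota 0) find_size.
Qed.

Lemma dist_walk r k x y : walk r k x y -> walk r (dist r x y) x y.
Proof.
case/walk_dipath=> p pxy _; pose ks := iota 0 #|T|.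
have hs : has (fun k => walk r k x y) ks.
  apply/hasP; exists (size p); last exact: dipath_walk.
  rewrite mem_iota /=; case/and3P: pxy => _ _ /card_uniqP /= <-.
  exact: max_card.
have := nth_find 0 hs; rewrite nth_iota //.
by rewrite -[ltnRHS](size_iota 0) -has_find.
Qed.

End Walks.

(** * Colouring by a maximum cut *)

Section Colouring.

(* Maximise the cut: a vertex without neighbour of the other colour could be
   flipped. *)
Lemma opposite_colouring (T : finType) (L : rel T) (F f : T -> bool) :
  symmetric L -> irreflexive L ->
  exists c : T -> bool, (forall v, F v -> c v = f v) /\
    (forall v w, ~~ F v -> L v w -> exists2 u, L v u & c u != c v).
Proof.
move=> Ls Li.
pose P (c : {ffun T -> bool}) := [forall v, F v ==> (c v == f v)].
pose cut (c : {ffun T -> bool}) := [set u : T * T | L u.1 u.2 & c u.1 != c u.2].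
have P0 : P (finfun f) by apply/forallP=> v; rewrite ffunE eqxx implybT.
case: (@arg_maxnP _ (finfun f) P (fun c => #|cut c|) P0) => c Pc maxc.
exists c; split=> [v Fv|v w Fv Lvw].
  by have /forallP/(_ v)/implyP/(_ Fv)/eqP := Pc.
have [/existsP[u /andP[Lvu ne]]|/existsPn no] :=
  boolP [exists u, L v u && (c u != c v)]; first by exists u.
have same u : L v u -> c u = c v.
  by move=> Lvu; have := no u; rewrite Lvu negbK => /eqP.
pose c' := [ffun u => if u == v then ~~ c v else c u].
have Pc' : P c'.
  apply/forallP=> u; apply/implyP=> Fu; rewrite ffunE.
  case: (u =P v) => [uv|_]; first by rewrite uv (negPf Fv) in Fu.
  by have /forallP/(_ u)/implyP/(_ Fu) := Pc.
have := maxc _ Pc'; rewrite /= leqNgt => /negP[]; apply: proper_card.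
apply/properP; split.
  apply/subsetP=> -[x y]; rewrite !inE /= => /andP[Lxy ne]; rewrite Lxy !ffunE /=.
  case: (x =P v) => [xv|_]; first by move: ne; rewrite xv (same y) ?eqxx // -xv.
  by case: (y =P v) => // yv; move: ne; rewrite yv (same x) ?eqxx // -yv Ls.
exists (v, w); rewrite !inE /= Lvw /= ?(same w) ?eqxx // !ffunE eqxx.
case: (w =P v) => [wv|_]; first by rewrite wv Li in Lvw.
by rewrite (same w) //; case: (c v).
Qed.

End Colouring.

(** * Weighted partial orientations and their growth *)

Section Spans.

Variable G : sgraph.
Implicit Types (o n : rel G) (D : {set G}) (a b : G -> nat).

(* [a y] bounds the cost of reaching [y] from a virtual arc at the root of the
   construction, and [b x] the cost of reaching that arc from [x]. *)
Definition spans o D a b : Prop :=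
  [/\ subrel o (@adj G), forall x y, o x y -> ~~ o y x,
      forall x y, o x y -> (x \in D) && (y \in D)
    & forall x y, x \in D -> y \in D ->
        exists2 k, k <= b x + a y + 1 & walk o k x y].

(** A walk from [x] to [y] is composed of new arcs leading into [D], an old walk inside [D], and new
    arcs leading out of [D]. No new arc joins two vertices of [D], so new and old arcs never oppose
    each other. *)
Lemma grow o n D D' a b a' b' :
  spans o D a b -> D \subset D' -> subrel n (@adj G) ->
  (forall x y, n x y -> ~~ n y x) ->
  (forall x y, n x y -> ~~ ((x \in D) && (y \in D))) ->
  {in D, a' =1 a} -> {in D, b' =1 b} ->
  let n' := [rel x y | [&& n x y, x \in D' & y \in D']] in
  (forall v, v \in D' -> v \notin D ->
     exists c k, [/\ c \in D, walk n' k c v & a c + k <= a' v]) ->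
  (forall v, v \in D' -> v \notin D ->
     exists c k, [/\ c \in D, walk n' k v c & b c + k <= b' v]) ->
  exists o', spans o' D' a' b'.
Proof.
case=> oadj oanti oD oW /subsetP sDD' nadj nanti nD aE bE n' toV fromV.
exists [rel x y | o x y || n' x y]; split=> /=.
- by move=> x y /orP[/oadj|/and3P[/nadj]].
- move=> x y /orP[oxy|/and3P[nxy xD yD]].
    rewrite (negPf (oanti _ _ oxy)) /=; apply/negP=> /and3P[/nD].
    by rewrite andbC (oD _ _ oxy).
  rewrite (negPf (nanti _ _ nxy)) /= orbF; apply/negP=> /oD.
  by rewrite andbC (negPf (nD _ _ nxy)).
- move=> x y /orP[/oD/andP[xD yD]|/and3P[_ -> ->]//].
  by rewrite !sDD'.
move=> x y xD' yD'.
have so : subrel o [rel x y | o x y || n' x y] by move=> u v /= ->.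
have sn : subrel n' [rel x y | o x y || n' x y] by move=> u v /= ->; rewrite orbT.
have [c [k [cD wc kc]]] : exists c k,
    [/\ c \in D, walk [rel x y | o x y || n' x y] k x c & b c + k <= b' x].
  have [xD|/(fromV _ xD')] := boolP (x \in D).
    by exists x, 0; rewrite addn0 bE //=.
  by case=> c [k [cD /(walk_sub sn) w le]]; exists c, k.
have [d [l [dD wd ld]]] : exists c k,
    [/\ c \in D, walk [rel x y | o x y || n' x y] k c y & a c + k <= a' y].
  have [yD|/(toV _ yD')] := boolP (y \in D).
    by exists y, 0; rewrite addn0 aE //=.
  by case=> d [l [dD /(walk_sub sn) w le]]; exists d, l.
have [m lem /(walk_sub so) wm] := oW _ _ cD dD.
exists (k + (m + l)); first lia.
exact: walk_cat wc (walk_cat wm wd).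
Qed.

Definition extend D a beta v : nat := if v \in D then a v else beta.

(** The vertices added are those on short [n]-walks from [D] to [D]. The condition bounds the total
    length [i + j], so all vertices of such a walk share it. If [v] is outside [D], both parts of
    the walk are nonempty; hence the bound [beta.+1] on the whole leaves at most [beta] for either
    part. *)
Lemma grow_walks o n D a b beta :
  spans o D a b -> subrel n (@adj G) ->
  (forall x y, n x y -> ~~ n y x) ->
  (forall x y, n x y -> ~~ ((x \in D) && (y \in D))) ->
  exists D' o', [/\ D \subset D', spans o' D' (extend D a beta) (extend D b beta)
    & forall v c d i j, c \in D -> d \in D -> walk n i c v -> walk n j v d ->
        a c + (i + j) <= beta.+1 -> b d + (i + j) <= beta.+1 -> v \in D'].
Proof.
move=> sp nadj nanti nD.
(* The cost bounds make both lengths smaller than [N], so [J] can quantify over finite types and be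
   boolean. *)
pose N := beta.+2.
pose J v := [exists c, exists d, exists i : 'I_N, exists j : 'I_N,
  [&& c \in D, d \in D, walk n i c v, walk n j v d,
      a c + (i + j) <= beta.+1 & b d + (i + j) <= beta.+1]].
have JP v c d i j : c \in D -> d \in D -> walk n i c v -> walk n j v d ->
    a c + (i + j) <= beta.+1 -> b d + (i + j) <= beta.+1 -> J v.
  move=> cD dD wc wd la lb; apply/existsP; exists c; apply/existsP; exists d.
  have ltiN : i < N by rewrite /N; lia.
  have ltjN : j < N by rewrite /N; lia.
  apply/existsP; exists (Ordinal ltiN); apply/existsP; exists (Ordinal ltjN).
  by rewrite cD dD wc wd la lb.
pose D' := D :|: [set v | J v].
have sDD' : D \subset D' by rewrite subsetUl.
have ext e : {in D, extend D e beta =1 e} by move=> v vD; rewrite /extend vD.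
have inD' v : J v -> v \in D' by rewrite !inE => ->; rewrite orbT.
have [o' spo'] : exists o', spans o' D' (extend D a beta) (extend D b beta).
  apply: grow sp sDD' nadj nanti nD (ext a) (ext b) _ _ => v.
    rewrite inE => /orP[-> //|]; rewrite inE.
    case/existsP=> c /existsP[d /existsP[i /existsP[j]]].
    case/and5P=> cD dD wc wd /andP[la lb] vD; exists c, i; split=> //.
      apply: walk_restrict => // i1 i2 t Ei w1 w2; apply: inD'.
      apply: (JP t c d i1 (i2 + j)) => //; rewrite ?[i1 + _]addnA ?Ei //.
      exact: walk_cat w2 wd.
    rewrite /extend (negPf vD); case: (nat_of_ord j) wd la lb => [|j'] //=.
      by move/eqP=> vd; rewrite vd dD in vD.
    by move=> _; lia.
  rewrite inE => /orP[-> //|]; rewrite inE.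
  case/existsP=> c /existsP[d /existsP[i /existsP[j]]].
  case/and5P=> cD dD wc wd /andP[la lb] vD; exists d, j; split=> //.
    apply: walk_restrict => // i1 i2 t Ei w1 w2; apply: inD'.
    apply: (JP t c d (i + i1) i2) => //; rewrite -?[_ + i2]addnA ?Ei //.
    exact: walk_cat wc w1.
  rewrite /extend (negPf vD); case: (nat_of_ord i) wc la lb => [|j'] //=.
    by move/eqP=> vd; rewrite -vd cD in vD.
  by move=> _; lia.
exists D', o'; split=> // v c d i j cD dD wc wd la lb.
exact/inD'/(JP v c d i j).
Qed.

End Spans.

(** * Ears through a forest attached to [D] *)

Section Ears.

Variable G : sgraph.
Implicit Types (o n : rel G) (D : {set G}) (a b : G -> nat).

Lemma adj_neq (x y : G) : adj x y -> x != y.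
Proof. by apply: contraTneq => ->; rewrite adj_irrefl. Qed.

Definition rim (D D0 : {set G}) : {set G} :=
  [set v | (v \notin D) && [exists u in D0, adj u v]].

Lemma rimP D D0 v :
  reflect (v \notin D /\ exists2 u, u \in D0 & adj u v) (v \in rim D D0).
Proof.
rewrite inE; apply: (iffP andP) => -[vD].
  by case/existsP=> u /andP[uD uv]; split=> //; exists u.
by case=> u uD uv; split=> //; apply/existsP; exists u; rewrite uD.
Qed.

Section Forest.

Variables (D D0 : {set G}) (e : nat) (rt h : G -> G).

(** [rt] gives the root of the tree of a vertex, and [h] the vertex of [D] to which a root is
    attached. A hit closes an ear [h v], [v], [x], [y] of length [2 + (x != v)]. *)
Definition hits (P : pred G) v : bool :=
  [exists x, exists y, [&& x \notin D, y \in D, adj x y, rt x == v,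
     (x != v) <= e, (x, y) != (v, h v) & P y]].

(** A link closes an ear through two trees, of length [3 + (x != v) + (y != r)]. A root outside
    [rim D D0] counts one more, because its attachment may be heavier by one. *)
Definition link v r : bool :=
  [&& v != r, v \in rim D D, r \in rim D D &
    [exists x, exists y, [&& x \notin D, y \notin D, adj x y, rt x == v,
      rt y == r & (x != v) + (y != r) + (v \notin rim D D0) + (r \notin rim D D0) <= e]]].

Lemma link_sym : symmetric link.
Proof.
have imp v r : link v r -> link r v.
  case/and4P=> vr vD rD /existsP[x /existsP[y]].
  case/and5P=> xD yD xy rx /andP[ry le].
  rewrite /link eq_sym vr vD rD /=; apply/existsP; exists y; apply/existsP.
  by exists x; rewrite yD xD adj_sym xy rx ry /= [(y != r) + _]addnC addnAC.
by move=> v r; apply/idP/idP; apply: imp.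
Qed.

Lemma link_irrefl : irreflexive link.
Proof. by move=> v; rewrite /link eqxx. Qed.

Variable c : G -> bool.

(** Colour [true] directs a tree away from [D]: in by the attaching edge, from the root to the
    leaves, and out by any other edge to [D]; colour [false] reverses all this. Edges between two
    leaves of a tree or between trees of one colour get no direction here. *)
Definition ear_arc : rel G := fun x y => adj x y &&
  if x \in D then (y \notin D) && (c (rt y) == ((h y == x) && (rt y == y)))
  else if y \in D then c (rt x) != ((h x == y) && (rt x == x))
  else if rt x == rt y then (if c (rt x) then rt x == x else rt y == y)
  else c (rt x) && ~~ c (rt y).

Lemma ear_arc_adj : subrel ear_arc (@adj G).
Proof. by move=> x y /andP[]. Qed.

Lemma ear_arc_anti x y : ear_arc x y -> ~~ ear_arc y x.
Proof.
rewrite /ear_arc => /andP[xy]; rewrite adj_sym xy /=.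
have [xD|xD] := boolP (x \in D); have [yD|yD] := boolP (y \in D) => //=.
  by move=> ->.
rewrite [rt y == rt x]eq_sym; case: eqP => [->|_].
  by case: ifP => _ /eqP e1; apply/eqP => e2; have /eqP[] := adj_neq xy; congruence.
by case/andP=> ->; rewrite andbF.
Qed.

Lemma ear_arc_out x y : ear_arc x y -> ~~ ((x \in D) && (y \in D)).
Proof. by rewrite /ear_arc; case: (x \in D); case: (y \in D); rewrite ?andbF. Qed.

Hypothesis rt_out : forall x, x \notin D -> rt x \notin D /\ rt (rt x) = rt x.
Hypothesis rt_adj : forall x, x \notin D -> rt x != x ->
  rt x \in rim D D0 /\ adj x (rt x).
Hypothesis h_rim : forall v, v \in rim D D -> h v \in D /\ adj v (h v).

Lemma ear_down x : x \notin D -> c (rt x) -> walk ear_arc (x != rt x) (rt x) x.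
Proof.
move=> xD cx; case: eqP => [<- //=|/eqP ne].
rewrite eq_sym in ne; have [_ ax] := rt_adj xD ne; have [rD rr] := rt_out xD.
by apply: walk1; rewrite /ear_arc adj_sym ax (negPf rD) (negPf xD) rr eqxx cx.
Qed.

Lemma ear_up x : x \notin D -> ~~ c (rt x) -> walk ear_arc (x != rt x) x (rt x).
Proof.
move=> xD cx; case: eqP => [<- //=|/eqP ne].
rewrite eq_sym in ne; have [_ ax] := rt_adj xD ne; have [rD rr] := rt_out xD.
by apply: walk1; rewrite /ear_arc ax (negPf rD) (negPf xD) rr eqxx (negPf cx).
Qed.

Lemma ear_in v : v \in rim D D -> rt v = v -> c v -> ear_arc (h v) v.
Proof.
move=> vR rv cv; have [hD av] := h_rim vR; have [vD _] := rimP _ _ _ vR.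
by rewrite /ear_arc adj_sym av hD vD rv cv !eqxx.
Qed.

Lemma ear_out v : v \in rim D D -> rt v = v -> ~~ c v -> ear_arc v (h v).
Proof.
move=> vR rv cv; have [hD av] := h_rim vR; have [vD _] := rimP _ _ _ vR.
by rewrite /ear_arc av hD (negPf vD) rv (negPf cv) !eqxx.
Qed.

End Forest.

(** Every root in [rim D D0] lies on a directed ear, closed by a hit or by a link to a root of the
    other colour. The ear has length at most [2 + e] if an end has weight [alpha.+1] and at most
    [3 + e] if both have weight [alpha], which is the bound of [grow_walks] for
    [beta = alpha + 2 + e]. *)
Lemma ears o D a b (D0 : {set G}) alpha e (rt h : G -> G) :
  spans o D a b -> D0 \subset D ->
  (forall u, u \in D0 -> a u <= alpha /\ b u <= alpha) ->
  (forall u, u \in D -> (a u <= alpha.+1) || (b u <= alpha.+1)) ->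
  (forall x, x \notin D -> rt x \notin D /\ rt (rt x) = rt x) ->
  (forall x, x \notin D -> rt x != x -> rt x \in rim D D0 /\ adj x (rt x)) ->
  (forall v, v \in rim D D0 -> rt v = v /\ h v \in D0) ->
  (forall v, v \in rim D D -> h v \in D /\ adj v (h v)) ->
  (forall v, v \in rim D D0 ->
     hits D e rt h predT v \/ exists r, link D D0 e rt v r) ->
  exists D' o', [/\ D \subset D', rim D D0 \subset D'
    & spans o' D' (extend D a (alpha + 2 + e)) (extend D b (alpha + 2 + e))].
Proof.
move=> sp /subsetP sD0 lowD0 lowD rt_out rt_adj rootR h_rim ear.
set R := rim D D0.
have RD v : v \in R -> v \in rim D D.
  case/rimP=> vD [u uD0 uv]; apply/rimP; split=> //.
  by exists u => //; apply: sD0.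
(* A root whose tree meets [D] again needs no second tree, but the weights of the
   meeting vertex may prescribe its colour; so does the attachment of a root
   outside [R]. *)
pose hitb := hits D e rt h (fun y => b y <= alpha.+1).
pose hita := hits D e rt h (fun y => a y <= alpha.+1).
pose F v := (v \notin R) || hitb v || hita v.
pose f v := if v \in R then hitb v else a (h v) <= alpha.+1.
have [c [cF cL]] := opposite_colouring F f (@link_sym D D0 e rt) (@link_irrefl D D0 e rt).
(* Only one weight of an attachment matters: [a] if the tree is directed away from [D], [b]
   otherwise. *)
have ca v : v \in rim D D -> c v -> a (h v) <= alpha + (v \notin R).
  move=> vD cv; have [vR|vR] := boolP (v \in R).
    by rewrite addn0; have [_ /lowD0[]] := rootR v vR.
  by rewrite addn1; move: cv; rewrite cF /F ?vR // /f (negPf vR).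
have cb v : v \in rim D D -> ~~ c v -> b (h v) <= alpha + (v \notin R).
  move=> vD cv; have [vR|vR] := boolP (v \in R).
    by rewrite addn0; have [_ /lowD0[]] := rootR v vR.
  rewrite addn1; move: cv; rewrite cF /F ?vR // /f (negPf vR).
  by case: (h_rim v vD) => /lowD; case: (a _ <= _).
pose n := ear_arc D rt h c.
have [D' [o' [sDD' spo' inD']]] := grow_walks (alpha + 2 + e) sp
  (@ear_arc_adj D rt h c) (@ear_arc_anti D rt h c) (@ear_arc_out D rt h c).
exists D', o'; split=> //.
have linkD' v r : link D D0 e rt v r -> c v -> ~~ c r -> (v \in D') && (r \in D').
  case/and4P=> vr vD rD /existsP[x /existsP[y]].
  case/and5P=> xD yD xy /eqP rx /andP[/eqP ry le] cv cr.
  have [_ rv] := rt_out x xD; rewrite rx in rv.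
  have [_ rr] := rt_out y yD; rewrite ry in rr.
  have w1 : walk n 1 (h v) v by apply/walk1/ear_in.
  have w5 : walk n 1 r (h r) by apply/walk1/ear_out.
  have w2 : walk n (x != v) v x.
    by have := ear_down h rt_out rt_adj xD (c := c); rewrite rx; apply.
  have w4 : walk n (y != r) y r.
    by have := ear_up h rt_out rt_adj yD (c := c); rewrite ry; apply.
  have w3 : walk n 1 x y.
    apply: walk1; rewrite /n /ear_arc xy (negPf xD) (negPf yD) rx ry.
    by rewrite (negPf vr) cv cr.
  have w25 := walk_cat w2 (walk_cat w3 (walk_cat w4 w5)).
  have w14 := walk_cat w1 (walk_cat w2 (walk_cat w3 w4)).
  have := ca v vD cv; have := cb r rD cr.
  have [hv _] := h_rim v vD; have [hr _] := h_rim r rD.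
  (* An attachment outside [D0] may add one to the weight; [link] has deducted it from the allowed
     length. *)
  have low m t l : m <= alpha + t -> t <= (v \notin R) + (r \notin R) ->
      l = (x != v) + (y != r) + 3 -> m + l <= (alpha + 2 + e).+1.
    move: le; rewrite -/R.
    move: (nat_of_bool _) (nat_of_bool _) (nat_of_bool _) (nat_of_bool _).
    by clear; lia.
  move=> /low lb /low la.
  have len l : l = (x != v) + (y != r) + 3 ->
      (a (h v) + l <= (alpha + 2 + e).+1) /\ (b (h r) + l <= (alpha + 2 + e).+1).
    by move=> El; split; [apply: la => //; apply: leq_addr | apply: lb => //; apply: leq_addl].
  have El1 : 1 + ((x != v) + (1 + ((y != r) + 1))) = (x != v) + (y != r) + 3.
    by move: (nat_of_bool _) (nat_of_bool _); clear; lia.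
  have El2 : 1 + ((x != v) + (1 + (y != r))) + 1 = (x != v) + (y != r) + 3.
    by move: (nat_of_bool _) (nat_of_bool _); clear; lia.
  have [la1 lb1] := len _ El1; have [la2 lb2] := len _ El2.
  by apply/andP; split; [apply: inD' hv hr w1 w25 la1 lb1
                        |apply: inD' hv hr w14 w5 la2 lb2].
apply/subsetP=> v vR; have vD := RD v vR; have [rv hvD0] := rootR v vR.
have [hva hvb] := lowD0 _ hvD0; have [hv _] := h_rim v vD.
have [vnD _] := rimP _ _ _ vD.
have [Fv|nFv] := boolP (F v); last first.
  have [hit|[r Lvr]] := ear v vR.
    case/negP: nFv; rewrite /F vR /=; apply/orP.
    case/existsP: hit => x /existsP[y /and5P[xD yD xy rx /and3P[le ne _]]].
    have /orP[l|l] := lowD y yD; [right|left];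
      by apply/existsP; exists x; apply/existsP; exists y; apply/and5P; split=> //; apply/and3P.
  have [s Lvs cs] := cL v r nFv Lvr.
  move: cs; have [cv cs|cv cs] := boolP (c v).
    have ncs : ~~ c s by case: (c s) cs.
    by have /andP[] := linkD' v s Lvs cv ncs.
  have cs' : c s by case: (c s) cs.
  by rewrite link_sym in Lvs; have /andP[] := linkD' s v Lvs cs' cv.
(* The edge of a hit is not the attaching edge, so [ear_arc] directs it so as to close the ear. *)
have hitE x y : rt x = v -> (x, y) != (v, h v) -> (h x == y) && (rt x == x) = false.
  by move=> rx; apply: contraNF => /andP[/eqP <- /eqP E]; rewrite -{1}E rx -E rx.
have := cF v Fv; rewrite /f vR; move: Fv; rewrite /F vR /=.
have [hit _ cv|nhit /= hit cv] := boolP (hitb v).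
  case/existsP: hit => x /existsP[y /and5P[xD yD xy /eqP rx /and3P[le ne lby]]].
  have w1 : walk n 1 (h v) v by apply/walk1/ear_in.
  have w2 : walk n (x != v) v x.
    by have := ear_down h rt_out rt_adj xD (c := c); rewrite rx; apply.
  have w3 : walk n 1 x y.
    by apply: walk1; rewrite /n /ear_arc xy (negPf xD) yD (hitE x y) // rx cv.
  by apply: (inD' _ _ _ _ _ hv yD w1 (walk_cat w2 w3));
    [move: hva | move: lby]; move: le (leq_b1 (x != v)); clear;
    move: (nat_of_bool _); lia.
case/existsP: hit => x /existsP[y /and5P[xD yD xy /eqP rx /and3P[le ne lay]]].
have ncv : ~~ c v by rewrite cv.
have w1 : walk n 1 v (h v) by apply/walk1/ear_out.
have w2 : walk n (x != v) x v.
  by have := ear_up h rt_out rt_adj xD (c := c); rewrite rx; apply.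
have w3 : walk n 1 y x.
  apply: walk1; rewrite /n /ear_arc adj_sym xy xD yD /= (hitE x y) // rx.
  by rewrite cv.
by apply: (inD' _ _ _ _ _ yD hv (walk_cat w3 w2) w1);
  [move: lay | move: hvb]; move: le (leq_b1 (x != v)); clear;
  move: (nat_of_bool _); lia.
Qed.

Lemma rim_sub D (D0 : {set G}) : D0 \subset D -> rim D D0 \subset rim D D.
Proof.
move/subsetP=> sD0; apply/subsetP=> v /rimP[vD [u uD0 uv]].
by apply/rimP; split=> //; exists u => //; apply: sD0.
Qed.

(** The trees are stars: a vertex outside [rim D D0] with neighbours in it joins one of them, and
    all other vertices are roots. Attachments are chosen in [D0] whenever possible. *)
Lemma forest D (D0 : {set G}) : D0 \subset D ->
  exists rt h : G -> G,
  [/\ forall x, x \notin D -> rt x \notin D /\ rt (rt x) = rt x,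
      forall x, x \notin D -> rt x != x -> rt x \in rim D D0 /\ adj x (rt x),
      forall v, v \in rim D D0 -> rt v = v /\ h v \in D0,
      forall v, v \in rim D D -> h v \in D /\ adj v (h v)
    & forall x v, v \in rim D D0 -> adj x v -> rt x \in rim D D0].
Proof.
move=> /subsetP sD0; set R := rim D D0.
have RD v : v \in R -> v \notin D by case/rimP.
pose rt x := if x \in R then x else odflt x [pick v in R | adj x v].
pose h v := if [pick u in D0 | adj v u] is Some u then u
            else odflt v [pick u in D | adj v u].
have rtR x : x \in R -> rt x = x by rewrite /rt => ->.
exists rt, h; split.
- move=> x xD; have [xR|xR] := boolP (x \in R); first by rewrite !rtR.
  have Erx : rt x = odflt x [pick v in R | adj x v] by rewrite /rt (negPf xR).
  move: (Erx); case: pickP => [v /andP[vR _] /= ->|_ /= E]; first by rewrite RD // rtR.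
  by rewrite !E.
- move=> x xD; have [xR|xR] := boolP (x \in R); first by rewrite rtR ?eqxx.
  rewrite /rt (negPf xR); case: pickP => [v /andP[] //|_].
  by rewrite eqxx.
- move=> v vR; split; first exact: rtR.
  rewrite /h; case: pickP => [u /andP[] //|no].
  by have [_ [u uD0 uv]] := rimP _ _ _ vR; move: (no u); rewrite uD0 adj_sym uv.
- move=> v /rimP[vD [u uD uv]]; rewrite /h.
  case: pickP => [w /andP[/sD0] //|_].
  by case: pickP => [w /andP[] //|/(_ u)]; rewrite uD adj_sym uv.
move=> x v vR xv; rewrite /rt; case: ifP => // _.
by case: pickP => [w /andP[] //|/(_ v)]; rewrite vR xv.
Qed.

Lemma hits_intro D e rt h v x y : x \notin D -> y \in D -> adj x y -> rt x = v ->
  (x != v) <= e -> (x, y) != (v, h v) -> hits D e rt h predT v.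
Proof.
move=> xD yD xy rx le ne; apply/existsP; exists x; apply/existsP; exists y.
by rewrite xD yD xy rx eqxx le ne.
Qed.

Lemma link_intro D D0 e rt v r x y : D0 \subset D ->
  v \in rim D D0 -> r \in rim D D0 -> v != r ->
  x \notin D -> y \notin D -> adj x y -> rt x = v -> rt y = r ->
  (x != v) + (y != r) <= e -> link D D0 e rt v r.
Proof.
move=> /rim_sub/subsetP sR vR rR vr xD yD xy rx ry le.
rewrite /link vr !sR //=; apply/existsP; exists x; apply/existsP; exists y.
by rewrite xD yD xy rx ry !eqxx vR rR !addn0.
Qed.

(** * Growth by triangles, by 4-cycles, and by absence of bridges *)

Section Steps.

Variables (o : rel G) (D D0 : {set G}) (a b : G -> nat) (alpha : nat).
Hypothesis sp : spans o D a b.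
Hypothesis sD0 : D0 \subset D.
Hypothesis lowD0 : forall u, u \in D0 -> a u <= alpha /\ b u <= alpha.
Hypothesis lowD : forall u, u \in D -> (a u <= alpha.+1) || (b u <= alpha.+1).

Definition grown k : Prop := exists D' o', [/\ D \subset D', rim D D0 \subset D'
    & spans o' D' (extend D a (alpha + k)) (extend D b (alpha + k))].

(** The ear uses [v] and perhaps [w], both of them roots, so [e = 0]. *)
Lemma ears_triangle :
  (forall u v, u \in D0 -> v \in rim D D0 -> adj u v ->
     exists w, [/\ w != u, adj v w & (w \in D) || (w \in rim D D0)]) ->
  grown 2.
Proof.
move=> tri; have [rt [h [rt1 rt2 rt3 h1 _]]] := forest sD0.
rewrite /grown -[alpha + 2]addn0; apply: (ears sp sD0 lowD0 lowD rt1 rt2 rt3 h1).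
move=> v vR; have [rv hv] := rt3 v vR.
have [_ av] := h1 v (subsetP (rim_sub sD0) v vR).
rewrite adj_sym in av; have [w [wh vw]] := tri _ _ hv vR av.
have [vD _] := rimP _ _ _ vR; case/orP=> [wD|wR].
  left; apply: (hits_intro (x := v) (y := w)); rewrite ?eqxx //.
  by rewrite xpair_eqE eqxx.
right; exists w; have [rw _] := rt3 w wR; have [wnD _] := rimP _ _ _ wR.
by apply: (link_intro (x := v) (y := w)); rewrite ?eqxx // adj_neq.
Qed.

(** The vertices of the short cycle next to [h v] lie in [D] or are roots; only [w], opposite to
    [h v] in a 4-cycle, can be a leaf, so [e = 1]. *)
Lemma ears_square :
  (forall u v, u \in D0 -> v \in rim D D0 -> adj u v ->
     (exists w, adj u w /\ adj v w) \/
     (exists w t, [/\ adj v w, adj w t, adj t u, w != u & t != v])) ->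
  grown 3.
Proof.
move=> sq; have [rt [h [rt1 rt2 rt3 h1 rt4]]] := forest sD0.
rewrite /grown (_ : alpha + 3 = alpha + 2 + 1); last by rewrite -addnA.
apply: (ears sp sD0 lowD0 lowD rt1 rt2 rt3 h1).
move=> v vR; have [rv hv] := rt3 v vR.
have [_ av] := h1 v (subsetP (rim_sub sD0) v vR).
rewrite adj_sym in av; have [vD _] := rimP _ _ _ vR.
have hit w : w \in D -> adj v w -> w != h v -> hits D 1 rt h predT v.
  move=> wD vw wh; apply: (hits_intro (x := v) (y := w)); rewrite ?eqxx //.
  by rewrite xpair_eqE eqxx.
have lnk w : w \in rim D D0 -> adj v w -> link D D0 1 rt v w.
  move=> wR vw; have [rw _] := rt3 w wR; have [wnD _] := rimP _ _ _ wR.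
  by apply: (link_intro (x := v) (y := w)); rewrite ?eqxx // adj_neq.
have inR u w : u \in D0 -> adj u w -> w \notin D -> w \in rim D D0.
  by move=> uD0 uw wD; apply/rimP; split=> //; exists u.
have [[w [uw vw]]|[w [t [vw wt tu wu tv]]]] := sq _ _ hv vR av.
  have [wD|wD] := boolP (w \in D).
    by left; apply: hit wD vw _; rewrite eq_sym adj_neq.
  by right; exists w; apply: lnk => //; apply: inR hv uw wD.
have [wD|wD] := boolP (w \in D); first by left; apply: hit wD vw wu.
have [wR|wR] := boolP (w \in rim D D0); first by right; exists w; apply: lnk.
(* Now [w] is a leaf. If its star is not that of [v], the edge [v w] links the two; otherwise the
   ear continues from [w] to [t]. *)
have rwR : rt w \in rim D D0 by apply: rt4 vR _; rewrite adj_sym.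
have [rwv|rwv] := eqVneq (rt w) v; last first.
  right; exists (rt w).
  apply: (link_intro (x := v) (y := w)); rewrite 1?eq_sym ?eqxx //.
  by case: (_ != _).
have [tD|tD] := boolP (t \in D).
  left; apply: (hits_intro (x := w) (y := t)) => //; first by case: (_ != _).
  by rewrite xpair_eqE; apply: contraNN wR => /andP[/eqP->].
have tR : t \in rim D D0 by apply: inR hv _ tD; rewrite adj_sym.
have [rtt _] := rt3 t tR; right; exists t.
apply: (link_intro (x := w) (y := t)) => //; first by rewrite eq_sym.
by rewrite eqxx addn0; case: (_ != _).
Qed.

Lemma connect_exit (r : rel G) (X : pred G) x y :
  connect r x y -> X x -> ~~ X y -> exists u v, [/\ X u, ~~ X v & r u v].
Proof.
case/connectP=> p + ->; elim: p x => [|z p IHp] x /=; first by move=> _ ->.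
case/andP=> rxz pz Xx nXy; have [Xz|nXz] := boolP (X z); first exact: IHp pz Xz nXy.
by exists x, z.
Qed.

(** Without the edge from [v] to [h v], a walk still joins its ends, and it leaves the star of [v]
    by some edge [x y]. If [y] is a leaf, its root is in [rim D D0]; if [y] is a root, it saves one
    step, which pays for an attachment outside [D0]. So [e = 2] suffices. *)
Lemma ears_bridgeless :
  (forall u v : G, adj u v -> connect (del_edge u v) u v) ->
  (forall x, x \notin D -> x \notin rim D D -> exists2 r, r \in rim D D0 & adj x r) ->
  grown 4.
Proof.
move=> nobr dom; have [rt [h [rt1 rt2 rt3 h1 rt4]]] := forest sD0.
rewrite /grown (_ : alpha + 4 = alpha + 2 + 2); last by rewrite -addnA.
apply: (ears sp sD0 lowD0 lowD rt1 rt2 rt3 h1).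
move=> v vR; have [rv hvD0] := rt3 v vR.
have [hv av] := h1 v (subsetP (rim_sub sD0) v vR); have [vD _] := rimP _ _ _ vR.
pose X := [pred x | (x \notin D) && (rt x == v)].
have [||x [y [/andP[xD /eqP rx]]]] := connect_exit (X := X) (nobr _ _ av).
- by rewrite /= vD rv eqxx.
- by rewrite /= hv.
rewrite /= negb_and negbK => nXy /andP[xy ne].
have [yD|yD] := boolP (y \in D).
  left; apply: (hits_intro (x := x) (y := y)) => //; first by case: (_ != _).
  by rewrite xpair_eqE; apply: contraNN ne => /andP[/eqP-> /eqP->].
rewrite (negPf yD) /= in nXy.
right; exists (rt y); have [ryy|ryy] := eqVneq (rt y) y; last first.
  have [ryR _] := rt2 y yD ryy.
  apply: (link_intro (x := x) (y := y)) => //; first by rewrite eq_sym.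
  by do 2!case: (_ != _).
(* Were [y] not next to [D], [dom] would make it a leaf. *)
have yrim : y \in rim D D.
  have [//|yrim] := boolP (y \in rim D D).
  have [r rR /(rt4 _ _ rR)] := dom y yD yrim.
  by rewrite ryy (negPf (contraNN (subsetP (rim_sub sD0) y) yrim)).
rewrite /link eq_sym nXy (subsetP (rim_sub sD0)) //= ryy yrim /=.
apply/existsP; exists x; apply/existsP; exists y.
by rewrite xD yD xy rx ryy !eqxx vR /=; case: (x != v); case: (y \notin rim D D0).
Qed.

End Steps.

End Ears.

(** * Diameters and components from walks *)

Section Diameter.

Variables (T : finType) (r : rel T).

Lemma is_dist_dist k x y : walk r k x y -> is_dist r x y (dist r x y).
Proof.
move=> w; split; last by move=> p /dipath_walk/dist_le.
have [p pxy le] := walk_dipath (dist_walk w); exists p => //.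
by apply/eqP; rewrite eqn_leq le; apply/dist_le/dipath_walk.
Qed.

Lemma diameter_exists N (x0 : T) :
  (forall x y, exists2 k, k <= N & walk r k x y) ->
  exists2 k, is_diameter r k & k <= N.
Proof.
move=> W; pose F (u : T * T) := dist r u.1 u.2.
have leN u : F u <= N.
  by have [k le w] := W u.1 u.2; apply: leq_trans (dist_le w) le.
have [|[x y] E] := @eq_bigmax _ F; first by apply/card_gt0P; exists (x0, x0).
exists (\max_u F u); last by apply/bigmax_leqP=> u _.
split; first by exists x, y; rewrite E; have [k _ w] := W x y; apply: is_dist_dist w.
move=> u v; exists (dist r u v); last exact: (leq_bigmax (u, v)).
by have [k _ w] := W u v; apply: is_dist_dist w.
Qed.

Lemma n_comp_le1 : (forall x y, connect r x y) -> n_comp r predT <= 1.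
Proof.
move=> cn; have rs : connect_sym r by move=> x y; rewrite !cn.
rewrite /n_comp_mem; apply/card_le1_eqP => x y; rewrite !inE !andbT.
move=> /eqP <- /eqP <-; exact/(rootP rs).
Qed.

Lemma connect_n_comp : connect_sym r -> n_comp r predT <= 1 ->
  forall x y, connect r x y.
Proof.
move=> rs /card_le1_eqP le x y; apply/(rootP rs); apply: le;
  by rewrite !inE roots_root.
Qed.

End Diameter.

(** * From weights to a strong orientation *)

Section Orient.

Variable G : sgraph.

Lemma del_edge_sym (u v : G) : symmetric (del_edge u v).
Proof. by move=> x y; rewrite /del_edge /= (adj_sym x) (setUC [set x]). Qed.

Lemma bridgeless_connect : @two_edge_connected G ->
  forall u v : G, adj u v -> connect (del_edge u v) u v.
Proof.
case=> cn nobr u v uv; apply: connect_n_comp.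
  exact/sym_connect_sym/del_edge_sym.
have := nobr u v; rewrite /bridge uv /= -leqNgt => /leq_trans; apply.
exact: n_comp_le1.
Qed.

(** Edges still without direction are directed by the enumeration of the vertices; the walks of [o]
    survive. *)
Lemma spans_orientation o a b N (x0 : G) :
  spans o [set: G] a b -> (forall x, a x <= N /\ b x <= N) ->
  exists o' : rel G,
    [/\ orientation o', strongly_connected o'
      & exists2 k, is_diameter o' k & k <= N + N + 1].
Proof.
case=> oadj oanti _ W le.
pose o' : rel G := [rel x y | o x y ||
  [&& adj x y, ~~ o y x & enum_rank x < enum_rank y]].
have W' x y : exists2 k, k <= N + N + 1 & walk o' k x y.
  have [k lek w] := W x y (in_setT _) (in_setT _); exists k.
    by have [? _] := le y; have [_ ?] := le x; lia.
  by apply: walk_sub w => u v ouv; rewrite /o' /= ouv.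
exists o'; split; last exact: diameter_exists W'.
  split=> x y /=; first by case/orP=> [/oadj|/and3P[]].
  move=> xy; rewrite /o' /= (adj_sym y x) xy /=.
  have := oanti x y; have := oanti y x.
  case: (o x y); case: (o y x) => //=; try by move=> _ /(_ isT).
  have /adj_neq := xy; rewrite -(inj_eq enum_rank_inj) -val_eqE /=.
  by case: ltngtP.
by move=> x y; have [k _ /walk_connect] := W' x y.
Qed.

End Orient.

Lemma nat_min (P : nat -> Prop) : (exists n, P n) ->
  exists2 n, P n & forall m, P m -> n <= m.
Proof.
case=> n; elim/ltn_ind: n => n IHn Pn.
have [[m ltmn Pm]|no] := classic (exists2 m, m < n & P m); first exact: IHn ltmn Pm.
by exists n => // m Pm; rewrite leqNgt; apply/negP => lt; apply: no; exists m.
Qed.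

Lemma nat_max (P : nat -> Prop) N : (exists n, P n) -> (forall n, P n -> n <= N) ->
  exists2 n, P n & forall m, P m -> m <= n.
Proof.
move=> [n Pn] le; have [|k [m Pm Ek] min] := @nat_min (fun k => exists2 m, P m & k = N - m).
  by exists (N - n), n.
exists m => // j Pj; have := min (N - j); rewrite Ek.
by move=> /(_ (ex_intro2 _ _ j Pj erefl)); have := le j Pj; have := le m Pm; lia.
Qed.

(** * The 8-cycle and the existence of the maximum *)

Section Cycle.

(** The 8-cycle shows that the graphs over which [is_f 4] takes the maximum exist at all. *)
Definition C8_adj : rel 'I_8 := fun x y => (ordS x == y) || (ordS y == x).

Lemma C8_sym : symmetric C8_adj.
Proof. by move=> x y; rewrite /C8_adj orbC. Qed.

Lemma C8_irrefl : irreflexive C8_adj.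
Proof.
by move=> x; rewrite /C8_adj orbb -val_eqE /=; case: x => x /= ltx; lia.
Qed.

Definition C8 := SGraph C8_sym C8_irrefl.

Lemma iter_ordS k (x : 'I_8) : iter k (@ordS 8) x = (x + k) %% 8 :> nat.
Proof.
elim: k => [|k IHk] /=; first by case: x => x ltx /=; lia.
by rewrite IHk; lia.
Qed.

Lemma C8_iter (x y : 'I_8) : iter ((y + 8 - x) %% 8) (@ordS 8) x = y.
Proof.
by apply: val_inj; rewrite /= iter_ordS; case: x y => x ltx [y lty] /=; lia.
Qed.

Lemma C8_walk k (x : C8) : walk (@adj C8) k x (iter k (@ordS 8) x).
Proof.
elim: k => [|k IHk]; first by rewrite /=.
by apply: walk_rcons IHk _; rewrite /= /C8_adj eqxx.
Qed.

(** Seven steps of [ordS] from [y] visit every vertex and avoid the edge [x y]. *)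
Lemma C8_bridgeless (x y u v : C8) : ordS x = y -> connect (del_edge x y) u v.
Proof.
move=> xy; have H k : k <= 7 -> connect (del_edge x y) y (iter k (@ordS 8) y).
  elim: k => [|k IHk] lek; first exact: connect0.
  apply: connect_trans (IHk (ltnW lek)) (connect1 _).
  apply/andP; split; first by apply/orP; left; apply/eqP.
  apply/eqP=> E.
  have /set2P hk : iter k (@ordS 8) y \in [set x; y] by rewrite -E set21.
  have /set2P hS : iter k.+1 (@ordS 8) y \in [set x; y] by rewrite -E set22.
  have Ey : (y : 'I_8) = (x + 1) %% 8 :> nat by rewrite -xy /= addn1.
  have Ek := iter_ordS k y; have ES := iter_ordS k.+1 y.
  have ltx := ltn_ord (x : 'I_8).
  by case: hk => hk; rewrite hk in Ek; case: hS => hS; rewrite hS in ES;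
    move: lek Ek ES; rewrite ?Ey; move: ltx; clear; lia.
have H' z : connect (del_edge x y) y z.
  by rewrite -(C8_iter y z); apply: H; lia.
apply: connect_trans (H' v).
by rewrite (sym_connect_sym (@del_edge_sym C8 x y)).
Qed.

Lemma C8_two_edge_connected : two_edge_connected C8.
Proof.
split=> [x y|x y].
  by rewrite -(C8_iter x y); apply: walk_connect (C8_walk _ _).
apply/negP=> /andP[xy lt].
have : n_comp (del_edge x y) predT <= 1.
  apply: n_comp_le1 => u v; case/orP: xy => /eqP xy; first exact: C8_bridgeless.
  have E : del_edge x y =2 del_edge y x.
    by move=> s t; rewrite /del_edge /= (setUC [set x]).
  by rewrite (eq_connect E); apply: C8_bridgeless.
have : 0 < n_comp (@adj C8) predT.
  by apply/card_gt0P; exists (root (@adj C8) x); rewrite !inE roots_root //;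
    apply/sym_connect_sym/adj_sym.
by move: lt; lia.
Qed.

Lemma C8_diameter : is_diameter (@adj C8) 4.
Proof.
(* The cyclic distance to 0 changes by at most one along an edge, so 0 and 4 are at distance at
   least 4. *)
have lip k (x y : C8) : walk (@adj C8) k x y ->
    minn (y : 'I_8) (8 - (y : 'I_8)) <= minn (x : 'I_8) (8 - (x : 'I_8)) + k.
  elim: k x => [|k IHk] x /=; first by move/eqP=> ->; lia.
  case/existsP=> z /andP[xz /IHk].
  move: xz; rewrite /C8_adj -!val_eqE /=.
  by case: (x : 'I_8) => i lti; case: (z : 'I_8) => j ltj /=; lia.
have W (x y : C8) : exists2 k, k <= 4 & walk (@adj C8) k x y.
  have [le|gt] := leqP ((y + 8 - x) %% 8) 4.
    by exists ((y + 8 - x) %% 8) => //; rewrite -{2}(C8_iter x y) C8_walk.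
  exists ((x + 8 - y) %% 8).
    by move: gt; case: (x : 'I_8) => i lti; case: (y : 'I_8) => j ltj /=; lia.
  by apply: walk_sym (@adj_sym C8) _; rewrite -{2}(C8_iter y x) C8_walk.
pose x0 : C8 := @Ordinal 8 0 isT; pose x4 : C8 := @Ordinal 8 4 isT.
split.
  exists x0, x4; have [k le w] := W x0 x4.
  have E : dist (@adj C8) x0 x4 = 4.
    apply/eqP; rewrite eqn_leq (leq_trans (dist_le w) le).
    by have := lip _ _ _ (dist_walk w).
  by rewrite -E; apply: is_dist_dist w.
move=> x y; exists (dist (@adj C8) x y); have [k le w] := W x y.
  exact: is_dist_dist w.
exact: leq_trans (dist_le w) le.
Qed.

End Cycle.

(** The oriented diameters form a set of numbers bounded by [N], nonempty by [C8], so a maximum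
    exists. *)
Lemma is_f_bound N :
  (forall G : sgraph, two_edge_connected G -> is_diameter (@adj G) 4 ->
     exists o : rel G,
       [/\ orientation o, strongly_connected o
         & exists2 k : nat, is_diameter o k & k <= N]) ->
  exists2 m : nat, is_f 4 m & m <= N.
Proof.
move=> bound.
have od (G : sgraph) : two_edge_connected G -> is_diameter (@adj G) 4 ->
    exists2 k, is_oriented_diameter G k & k <= N.
  move=> ec dG; have [o [oo _ [k dk lek]]] := bound G ec dG.
  have [|j ij minj] := @nat_min (fun k => exists2 o, @orientation G o & is_diameter o k).
    by exists k, o.
  exists j; last by apply: leq_trans lek; apply: minj; exists o.
  by split=> // o' i oo' di; apply: minj; exists o'.
have uniq (G : sgraph) i j : is_oriented_diameter G i -> is_oriented_diameter G j -> i <= j.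
  by move=> [_ mini] [[o oo dj] _]; apply: mini dj.
pose P m := exists G : sgraph, [/\ two_edge_connected G, is_diameter (@adj G) 4
                        & is_oriented_diameter G m].
have PN m : P m -> m <= N.
  by case=> G [ec dG om]; have [k ok le] := od G ec dG; apply: leq_trans (uniq _ _ _ om ok) le.
have [|m Pm maxm] := @nat_max P N _ PN.
  have [k ok _] := od _ C8_two_edge_connected C8_diameter.
  by exists k, C8; split=> //; [apply: C8_two_edge_connected | apply: C8_diameter].
exists m; last exact: PN.
split=> // G ec dG; have [k ok le] := od G ec dG; exists k => //.
by apply: maxm; exists G.
Qed.

(** * Bridgeless graphs of diameter at most 4 *)

Section DiameterFour.

Variable G : sgraph.
Hypothesis nobr : forall u v : G, adj u v -> connect (del_edge u v) u v.
Hypothesis diam4 : forall x y : G, exists2 k, k <= 4 & walk (@adj G) k x y.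

Let d : G -> G -> nat := dist (@adj G).

Lemma d_walk x y : walk (@adj G) (d x y) x y.
Proof. by have [k _ w] := diam4 x y; apply: dist_walk w. Qed.

Lemma d_le4 x y : d x y <= 4.
Proof. by have [k le w] := diam4 x y; apply: leq_trans (dist_le w) le. Qed.

Lemma d_le k x y z : walk (@adj G) k y z -> d x z <= d x y + k.
Proof. by move=> w; apply/dist_le/walk_cat/w/d_walk. Qed.

Lemma d_le_adj x y z : adj y z -> d x z <= d x y + 1.
Proof. by move/walk1; apply: d_le. Qed.

Lemma d_xx x : d x x = 0.
Proof. by apply/eqP; rewrite -leqn0; apply: dist_le => /=. Qed.

Lemma d_eq0 x y : d x y = 0 -> x = y.
Proof. by move=> E; have := d_walk x y; rewrite E /= => /eqP. Qed.

Lemma d_pred x y k : d x y = k.+1 -> exists2 z, adj z y & d x z = k.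
Proof.
move=> E; have := d_walk x y; rewrite E -addn1.
case/walk_split=> z w1 /= /existsP[t /andP[zt /eqP ty]]; rewrite ty in zt.
exists z => //; have := dist_le w1; rewrite -/(d _ _).
by have := d_le_adj x zt; rewrite E; lia.
Qed.

Lemma d_pred_edge p q x k : adj p q -> d p x = k.+1 -> d p x <= d q x ->
  exists z, [/\ adj z x, d p z = k & d q z = k \/ d q z = k.+1].
Proof.
move=> pq px le; have [z zx pz] := d_pred px; exists z; split=> //.
have := d_le_adj q zx; rewrite adj_sym in pq.
by have := dist_le (walk_cons pq (d_walk p z)); rewrite -/(d q z); lia.
Qed.

Definition within_ten : Prop :=
  exists o (a b : G -> nat), spans o [set: G] a b /\ (forall x, a x <= 10 /\ b x <= 10).

Lemma extend_le (D : {set G}) a beta N x :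
  (x \in D -> a x <= N) -> beta <= N -> extend D a beta x <= N.
Proof. by rewrite /extend; case: ifP => // _ /(_ isT). Qed.

(** In the absence of bridges each outside vertex has a second neighbour, which is in [D] or in the
    rim because [D0] dominates the outside. So [ears_triangle] applies, and [8 + 2 = 10]. *)
Lemma last_step o (D D0 : {set G}) a b :
  spans o D a b -> D0 \subset D ->
  (forall u, u \in D0 -> a u <= 8 /\ b u <= 8) ->
  (forall u, u \in D -> (a u <= 9) || (b u <= 9)) ->
  (forall u, u \in D -> a u <= 10 /\ b u <= 10) ->
  (forall x, x \notin D -> exists2 u, u \in D0 & adj u x) -> within_ten.
Proof.
move=> sp sD0 lowD0 lowD leD dom.
have inR x : x \notin D -> x \in rim D D0 by move=> xD; apply/rimP; split=> //; apply: dom.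
have [|D' [o' [/subsetP sDD' /subsetP sR sp']]] := ears_triangle sp sD0 lowD0 lowD.
  move=> u v uD0 vR uv; rewrite adj_sym in uv.
  have [||x [w [/eqP-> wv /andP[vw ne]]]] := connect_exit (X := pred1 v) (nobr uv).
  - exact: eqxx.
  - by rewrite /= eq_sym (adj_neq uv).
  exists w; split=> //; first by apply: contraNneq ne => ->.
  by case: (boolP (w \in D)) => //= /inR.
have D'T : D' = setT.
  by apply/setP=> x; rewrite inE; have [/sDD'|/inR/sR] := boolP (x \in D).
exists o', (extend D a (8 + 2)), (extend D b (8 + 2)); rewrite -D'T; split=> // x.
by split; apply: extend_le => // /leD[].
Qed.

(** Each round adds a distance layer around [c] and 2 to the weights; four rounds end at weight
    8. *)
Lemma all_triangles (c : G) :
  (forall u v : G, adj u v -> exists2 w, adj u w & adj v w) -> within_ten.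
Proof.
move=> tri.
have H k : exists o (D : {set G}) a b, [/\ spans o D a b,
   forall u, u \in D -> a u <= k * 2 /\ b u <= k * 2 & forall x, d c x <= k -> x \in D].
  elim: k => [|k [o [D [a [b [sp le near]]]]]].
    exists [rel _ _ | false], [set c], (fun=> 0), (fun=> 0); split=> //.
      by split=> // x y /set1P-> /set1P->; exists 0 => //=.
    by move=> x; rewrite leqn0 => /eqP /d_eq0 <-; rewrite set11.
  have lowD u : u \in D -> (a u <= (k * 2).+1) || (b u <= (k * 2).+1).
    by case/le=> /leqW-> _.
  have [|D' [o' [/subsetP sDD' /subsetP sR sp']]] := ears_triangle sp (subxx _) le lowD.
    move=> u v uD vR uv; have [w uw vw] := tri u v uv; exists w.
    rewrite eq_sym (adj_neq uw) vw; split=> //.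
    by case: (boolP (w \in D)) => //= wD; apply/rimP; split=> //; exists u.
  exists o', D', (extend D a (k * 2 + 2)), (extend D b (k * 2 + 2)); split=> //.
    by move=> u uD'; split; apply: extend_le => [/le[]|]; lia.
  move=> x; rewrite leq_eqVlt => /orP[/eqP E|]; last by rewrite ltnS => /near/sDD'.
  have [xD|xD] := boolP (x \in D); first exact: sDD'.
  have [z zx Ez] := d_pred E; apply: sR; apply/rimP; split=> //.
  by exists z => //; apply: near; rewrite Ez.
have [o [D [a [b [sp le near]]]]] := H 4.
have DT : D = setT by apply/setP=> x; rewrite inE near ?d_le4.
rewrite DT in sp le; exists o, a, b; split=> // x.
by have [] := le x (in_setT _); lia.
Qed.

(** * The ranked digraph of an edge in no triangle *)

Section RankCore.

Variables p q : G.
Hypothesis pq : adj p q.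
Hypothesis no_tri : forall z, adj p z -> ~~ adj q z.

Let dp := d p.
Let dq := d q.

Lemma dp_p : dp p = 0. Proof. exact: d_xx. Qed.
Lemma dq_q : dq q = 0. Proof. exact: d_xx. Qed.

Lemma dq_le x : dq x <= dp x + 1.
Proof.
have := dist_le (walk_cat (walk1 (etrans (adj_sym q p) pq)) (d_walk p x)).
by rewrite -/(d _ _) -/(dq x) -/(dp x) addnC.
Qed.

Lemma dp_le x : dp x <= dq x + 1.
Proof.
have := dist_le (walk_cat (walk1 pq) (d_walk q x)).
by rewrite -/(d _ _) -/(dq x) -/(dp x) addnC.
Qed.

Lemma dp_eq0 x : dp x = 0 -> x = p. Proof. by move/d_eq0. Qed.
Lemma dq_eq0 x : dq x = 0 -> x = q. Proof. by move/d_eq0. Qed.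

Lemma dq_p : dq p = 1.
Proof.
have := dq_le p; rewrite dp_p; case E: (dq p) => [|[|k]] // _.
by have := adj_neq pq; rewrite (dq_eq0 E) eqxx.
Qed.

Lemma dp_q : dp q = 1.
Proof.
have := dp_le q; rewrite dq_q; case E: (dp q) => [|[|k]] // _.
by have := adj_neq pq; rewrite (dp_eq0 E) eqxx.
Qed.

Lemma d_step x y : adj x y ->
  [/\ dp x <= dp y + 1, dp y <= dp x + 1, dq x <= dq y + 1 & dq y <= dq x + 1].
Proof.
move=> xy; have yx : adj y x by rewrite adj_sym.
by split; apply: d_le_adj.
Qed.

Lemma dp_adj x : dp x = 1 -> adj p x.
Proof. by case/d_pred=> z zx /d_eq0 ->. Qed.

Lemma dq_adj x : dq x = 1 -> adj q x.
Proof. by case/d_pred=> z zx /d_eq0 ->. Qed.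

Lemma no_M1 x : dp x = 1 -> dq x = 1 -> False.
Proof. by move=> /dp_adj/no_tri/negP no /dq_adj. Qed.

(* The vertices nearer to [p] come first, by increasing distance, then those at
   equal distance from [p] and [q], by decreasing distance, then those nearer
   to [q], by decreasing distance. *)
Definition rank x : nat :=
  if dp x < dq x then dp x else if dp x == dq x then 10 - dp x else 20 - dq x.

Definition rk : rel G := fun x y =>
  [&& adj x y, rank x < rank y & (x, y) != (p, q)].

(** A shortest path from [p] to a vertex nearer to [p] stays among such vertices, and there rank is
    distance to [p]. *)
Lemma rk_to_P x : dp x < dq x -> walk rk (dp x) p x.
Proof.
move E: (dp x) => k; elim: k x E => [|k IHk] x E lt.
  by rewrite (dp_eq0 E) /=.
have [y yx Ey] := d_pred E; have [_ _ ? ?] := d_step yx.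
have [? ?] := (dq_le y, dq_le x); rewrite -/(dp y) in Ey.
apply: walk_rcons (IHk y Ey _) _; first lia.
apply/and3P; split=> //; first by rewrite /rank !ifT; lia.
by apply/eqP=> -[_ xq]; move: lt; rewrite xq dq_q.
Qed.

(** Along a shortest path to [q] the distance to [q] drops by one and that to [p] by at most one, so
    the path never enters the side of [p]. Distances are at most 4, so the constants 10 and 20 keep
    the rank ranges apart. *)
Lemma rk_from_MQ x : dq x <= dp x -> walk rk (dq x) x q.
Proof.
move E: (dq x) => k; elim: k x E => [|k IHk] x E le.
  by rewrite (dq_eq0 E) /=.
have [y yx Ey] := d_pred E; have [? ? _ _] := d_step yx.
have [? ?] := (dp_le y, dp_le x); rewrite -/(dq y) in Ey.
rewrite adj_sym in yx; apply: walk_cons (IHk y Ey _); last lia.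
apply/and3P; split=> //.
  have [? ?] : dq x <= 4 /\ dp x <= 4 by split; apply: d_le4.
  by rewrite /rank; do ?case: ifP => ?; lia.
by apply/eqP=> -[xp _]; move: le; rewrite xp dp_p.
Qed.

Lemma rk_cross x y : adj x y -> (x, y) != (p, q) -> dp x < dq x -> dq y <= dp y ->
  rk x y.
Proof.
move=> xy ne lt le; rewrite /rk xy ne andbT /=.
have [? ? ?] : [/\ dq x <= 4, dp y <= 4 & dq y <= 4] by split; apply: d_le4.
by rewrite /rank lt ifF; last lia; case: ifP; lia.
Qed.

Lemma cross_walks x y : adj x y -> (x, y) != (p, q) -> dp x < dq x -> dq y <= dp y ->
  [/\ walk rk (dp x) p x, walk rk (dq y).+1 x q,
      walk rk (dp x).+1 p y & walk rk (dq y) y q].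
Proof.
move=> xy ne lt le; have r := rk_cross xy ne lt le.
have [w1 w2] := (rk_to_P lt, rk_from_MQ le).
by split=> //; [apply: walk_cons r w2 | apply: walk_rcons w1 r].
Qed.

(** From [x] one goes to [q], over the arc from [q] to [p], and on to [y]. Walks starting at [p] or
    ending at [q] can skip that arc, so [b p] and [a q] may be reset to [kappa]; the bound on [k0]
    serves the pair [p], [q]. *)
Lemma rank_core s kappa k0 : kappa <= s.*2 -> walk rk k0 p q ->
    k0 <= s.*2 -> k0 <= kappa.*2.+1 ->
  exists o (D : {set G}) a b, [/\ spans o D a b,
    forall x i j, walk rk i p x -> walk rk j x q -> i + j <= s.*2 ->
      [/\ x \in D, a x <= maxn i kappa & b x <= maxn j kappa],
    forall x, x \in D -> a x + b x <= s.*2,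
    p \in D /\ q \in D
    & [/\ a p <= kappa, b p <= kappa, a q <= kappa & b q <= kappa]].
Proof.
move=> les w0 k0s k0k.
pose al x := dist rk p x; pose be x := dist rk x q.
(* Reachability is demanded separately, as [dist] is [#|T|] on unreachable pairs. *)
pose D := [set x | [exists i : 'I_s.*2.+1, walk rk i p x] &&
   ([exists i : 'I_s.*2.+1, walk rk i x q] && (al x + be x <= s.*2))].
pose a x := if x == q then kappa else al x.
pose b x := if x == p then kappa else be x.
have inD x i j : walk rk i p x -> walk rk j x q -> i + j <= s.*2 -> x \in D.
  move=> wi wj le; have [lea leb] := (dist_le wi, dist_le wj).
  have lti : i < s.*2.+1 by lia.
  have ltj : j < s.*2.+1 by lia.
  rewrite inE; apply/and3P; split.
  - by apply/existsP; exists (Ordinal lti).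
  - by apply/existsP; exists (Ordinal ltj).
  by rewrite /al /be; lia.
have DW x : x \in D ->
    [/\ walk rk (al x) p x, walk rk (be x) x q & al x + be x <= s.*2].
  rewrite inE => /and3P[/existsP[i /dist_walk wi] /existsP[j /dist_walk wj] le].
  by split.
have pD : p \in D by apply: (inD p 0 k0) => //=.
have qD : q \in D by apply: (inD q k0 0) => //=; rewrite addn0.
pose r := [rel x y | [&& rk x y, x \in D & y \in D]].
have wp x : x \in D -> walk r (al x) p x.
  move=> /DW[w1 w2 le]; apply: walk_restrict w1 _ => i j t ij wi wj.
  by apply: (inD t i (j + be x)) => //; [apply: walk_cat wj w2 | lia].
have wq x : x \in D -> walk r (be x) x q.
  move=> /DW[w1 w2 le]; apply: walk_restrict w2 _ => i j t ij wi wj.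
  by apply: (inD t (al x + i) j) => //; [apply: walk_cat w1 wi | lia].
exists [rel x y | r x y || ((x == q) && (y == p))], D, a, b; split=> //.
- split=> /=.
  + by move=> x y /orP[/and3P[/and3P[]]|/andP[/eqP-> /eqP->]] //; rewrite adj_sym.
  + have anti x y : rk x y -> ~~ rk y x.
      by case/and3P=> _ lt _; apply/negP=> /and3P[_ gt _]; lia.
    move=> x y /orP[/and3P[rxy _ _]|/andP[/eqP-> /eqP->]].
      apply/negP=> /orP[/and3P[ryx _ _]|/andP[/eqP yq /eqP xp]].
        by rewrite (negPf (anti _ _ rxy)) in ryx.
      by case/and3P: rxy => _ _; rewrite xp yq eqxx.
    apply/negP=> /orP[/and3P[/and3P[_ _]]|/andP[pEq _]]; first by rewrite eqxx.
    by have := adj_neq pq; rewrite pEq.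
  + by move=> x y /orP[/and3P[_ -> ->]|/andP[/eqP-> /eqP->]] //; rewrite pD qD.
  move=> x y xD yD.
  have sr k u v : walk r k u v -> walk [rel x y | r x y || ((x == q) && (y == p))] k u v.
    by apply: walk_sub => s' t ruv; rewrite /= in ruv *; rewrite ruv.
  have [/sr wx /sr wy] := (wq x xD, wp y yD).
  have [xp|xp] := eqVneq x p.
    exists (al y); last by rewrite xp.
    rewrite /b /a xp eqxx; case: eqP => [yq|_]; last lia.
    by have := dist_le w0; rewrite /al yq; lia.
  have [yq|yq] := eqVneq y q.
    by exists (be x); [rewrite /b (negPf xp); lia | rewrite yq].
  exists (be x + (1 + al y)); first by rewrite /a /b (negPf xp) (negPf yq); lia.
  apply: walk_cat wx (walk_cat (walk1 _) wy).
  by rewrite /= !eqxx orbT.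
- move=> x i j wi wj le; split; first exact: inD wi wj le.
    by rewrite /a; case: eqP => _; have := dist_le wi; rewrite -/(al x); lia.
  by rewrite /b; case: eqP => _; have := dist_le wj; rewrite -/(be x); lia.
- have alp : al p = 0 by apply/eqP; rewrite -leqn0; apply: dist_le => /=.
  have beq : be q = 0 by apply/eqP; rewrite -leqn0; apply: dist_le => /=.
  move=> x xD; rewrite /a /b; case: eqP => [->|_].
    by rewrite eq_sym (negPf (adj_neq pq)) beq; lia.
  case: eqP => [->|_]; first by rewrite alp.
  by have [_ _] := DW x xD.
have alp : al p = 0 by apply/eqP; rewrite -leqn0; apply: dist_le => /=.
have beq : be q = 0 by apply/eqP; rewrite -leqn0; apply: dist_le => /=.
rewrite /a /b !eqxx [q == p]eq_sym (negPf (adj_neq pq)) alp beq.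
by split.
Qed.


(** * An edge in no triangle and in no 4-cycle *)

Section NoSquare.

Hypothesis no_sq : forall x y, adj p x -> adj x y -> adj y q ->
  x != q -> y != p -> False.

Lemma cross_dist x y : adj x y -> dp x < dq x -> dq y <= dp y ->
  [/\ dq x = (dp x).+1, dp x <= 3, dp x <= dq y & dq y <= (dp x).+1].
Proof.
move=> xy lt le; have [_ ? ? _] := d_step xy; have ? := dq_le x.
have [? ?] : dq x <= 4 /\ dq y <= 4 by split; apply: d_le4.
by split; lia.
Qed.

(** As [p q] is no bridge, another edge [x y] leaves the side of [p], and
    [dp x + 1 + dq y <= 3 + 1 + 4]. *)
Lemma walk_pq : exists2 k, k <= 8 & walk rk k p q.
Proof.
have [||x [y [lt]]] := connect_exit (X := [pred x | dp x < dq x]) (nobr pq).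
- by rewrite /= dp_p dq_p.
- by rewrite /= dp_q dq_q.
rewrite /= -leqNgt => le /andP[xy ne].
have ne' : (x, y) != (p, q) by apply: contraNneq ne => -[-> ->].
have [w _ _ w'] := cross_walks xy ne' lt le.
have [_ ? _ ?] := cross_dist xy lt le.
exists (dp x + (dq y).+1); first lia.
exact: walk_cat w (walk_cons (rk_cross xy ne' lt le) w').
Qed.

Variables (o : rel G) (D : {set G}) (a b : G -> nat).
Hypothesis core_walks : forall x i j, walk rk i p x -> walk rk j x q ->
  i + j <= 8 -> [/\ x \in D, a x <= maxn i 4 & b x <= maxn j 4].
Hypothesis pqD : p \in D /\ q \in D.
Hypothesis low_pq : [/\ a p <= 4, b p <= 4, a q <= 4 & b q <= 4].

Definition low_core : {set G} := [set u in D | (a u <= 4) && (b u <= 4)].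

Lemma low_core_p : p \in low_core.
Proof. by rewrite inE; case: pqD => -> _; case: low_pq => -> ->. Qed.

Lemma low_core_q : q \in low_core.
Proof. by rewrite inE; case: pqD => _ ->; case: low_pq => _ _ -> ->. Qed.

Lemma low_core_walks x i j : walk rk i p x -> walk rk j x q -> i <= 4 -> j <= 4 ->
  x \in low_core.
Proof.
move=> wi wj lei lej; have [|xD la lb] := core_walks wi wj; first lia.
by rewrite inE xD; apply/andP; split; lia.
Qed.

(** Through the crossing edge, [y] is reached from [p] in [dp x + 1 <= 4] steps, and [x] reaches [q]
    in [dq y + 1] steps. *)
Lemma low_core_cross x y : adj x y -> (x, y) != (p, q) -> dp x < dq x ->
  dq y <= dp y -> y \in low_core /\ (dq y <= 3 -> x \in low_core).
Proof.
move=> xy ne lt le; have [w1 w2 w3 w4] := cross_walks xy ne lt le.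
have [_ ? ? ?] := cross_dist xy lt le.
split; last by move=> le3; apply: low_core_walks w1 w2 _ _; lia.
by apply: low_core_walks w3 w4 _ _; rewrite ?d_le4.
Qed.

Definition near2 x := exists2 i, i <= 2 & exists2 u, u \in low_core & walk (@adj G) i x u.

Lemma near2_intro i x u : walk (@adj G) i x u -> i <= 2 -> u \in low_core -> near2 x.
Proof. by move=> w le uD; exists i => //; exists u. Qed.

Lemma walk_adj_sym k (x y : G) : walk (@adj G) k x y -> walk (@adj G) k y x.
Proof. by apply/walk_sym/adj_sym. Qed.

Lemma near2_p x : dp x <= 2 -> near2 x.
Proof. by move=> le; apply: near2_intro (walk_adj_sym (d_walk p x)) le low_core_p. Qed.

Lemma near2_q x : dq x <= 2 -> near2 x.
Proof. by move=> le; apply: near2_intro (walk_adj_sym (d_walk q x)) le low_core_q. Qed.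

(** For want of triangles, the predecessor [z] of [x] towards [p] is at distance 2 from [q], so the
    edge [z x] crosses. *)
Lemma low_core_M2 x : dp x = 2 -> dq x = 2 ->
  x \in low_core /\ exists2 z, rk z x & walk rk 1 p z.
Proof.
move=> px qx; have [z zx pz] := d_pred px; rewrite -/(dp z) in pz.
have [_ _ _ ?] := d_step zx; have ? := dq_le z.
have qz : dq z = 2.
  case E: (dq z) => [|[|[|k]]]; try lia; by case: (no_M1 pz E).
have ne : (z, x) != (p, q) by apply/eqP=> -[_ xq]; rewrite xq dq_q in qx.
have lt : dp z < dq z by lia.
have le : dq x <= dp x by lia.
have [xD _] := low_core_cross zx ne lt le; split=> //.
by exists z; [apply: rk_cross | have := rk_to_P lt; rewrite pz].
Qed.

Lemma low_core_M3 x : dp x = 3 -> dq x = 3 ->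
  exists2 i, i <= 1 & exists2 u, u \in low_core & walk (@adj G) i x u.
Proof.
move=> px qx; have [z zx pz] := d_pred px; rewrite -/(dp z) in pz.
have [_ _ ? ?] := d_step zx; have ? := dq_le z.
have [qz|qz] : dq z = 2 \/ dq z = 3 by lia.
  have [zD _] := low_core_M2 pz qz; exists 1 => //; exists z => //.
  by apply: walk1; rewrite adj_sym.
have ne : (z, x) != (p, q) by apply/eqP=> -[_ xq]; rewrite xq dq_q in qx.
have [xD _] : x \in low_core /\ (dq x <= 3 -> z \in low_core).
  by apply: low_core_cross => //; lia.
by exists 0 => //; exists x => //=.
Qed.

Lemma walk_exit (r : rel G) (X : pred G) k x y : walk r k x y -> X x -> ~~ X y ->
  exists i u v, [/\ i < k, walk r i x u, X u /\ ~~ X v, r u v & walk r (k - i.+1) v y].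
Proof.
elim: k x => [|k IHk] x /=; first by move/eqP=> -> ->.
case/existsP=> z /andP[rxz w] Xx nXy; have [Xz|nXz] := boolP (X z); last first.
  by exists 0, x, z; split; rewrite //= ?subn1.
have [i [u [v [lt w1 XX uv w2]]]] := IHk z w Xz nXy.
by exists i.+1, u, v; split=> //; apply: walk_cons rxz w1.
Qed.

Lemma Q1_exists : exists2 w, adj q w & dp w = 2 /\ dq w = 1.
Proof.
have [||x [y [/= xq yq /andP[xy ne]]]] := connect_exit (X := predC1 q) (nobr pq).
- by rewrite /= adj_neq.
- by rewrite /= eqxx.
rewrite negbK in yq; rewrite (eqP yq) in xy ne.
have qx : adj q x by rewrite adj_sym.
exists x => //; have [_ _ Hq _] := d_step xy; rewrite dq_q in Hq.
have q1 : dq x = 1.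
  by case E: (dq x) => [|k]; [rewrite (dq_eq0 E) eqxx in xq | lia].
split=> //; have [Hp _ _ _] := d_step xy; rewrite dp_q in Hp.
case E: (dp x) => [|[|[|k]]]; try lia.
  by rewrite (dp_eq0 E) eqxx in ne.
by case: (no_M1 E q1).
Qed.

(** A walk of length at most 4 from [x] to a neighbour [w] of [q] crosses at some edge [u v]. If
    this is the fourth edge, [p u w q] is a 4-cycle. Otherwise [v] is in the low core; at the third
    edge [dq v <= 2], so [u] is in it as well. *)
Lemma near2_P3 x : dp x = 3 -> dq x = 4 -> near2 x.
Proof.
move=> px qx; have [w qw [pw q1w]] := Q1_exists.
have [k lek wk] := diam4 x w.
have [||i [u [v [lti wi [Pu nPv] uv wv]]]] := walk_exit (X := [pred x | dp x < dq x]) wk.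
- by rewrite /= px qx.
- by rewrite /= pw q1w.
rewrite /= -leqNgt in Pu nPv; have [eu ? ? ?] := cross_dist uv Pu nPv.
have Hi := d_le p (walk_adj_sym wi); rewrite -/(dp x) -/(dp u) px in Hi.
have Hv := d_le q (walk_adj_sym wv); rewrite -/(dq v) -/(dq w) q1w in Hv.
have [i3|i2] : i = 3 \/ i <= 2 by lia.
  have k4 : k - i.+1 = 0 by lia.
  move: wv; rewrite k4 => /eqP vw; rewrite vw in uv nPv Hv.
  have [? ? ? ?] := d_step uv.
  have pu : dp u = 1 by lia.
  case: (no_sq (dp_adj pu) uv _); rewrite ?(adj_sym w) //.
    by apply/eqP=> uq; move: Pu; rewrite uq dq_q.
  by apply/eqP=> wp; rewrite wp dp_p in pw.
have ne : (u, v) != (p, q) by apply/eqP=> -[up _]; move: Hi; rewrite up dp_p; lia.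
have [vD uD] := low_core_cross uv ne Pu nPv.
have [i1|i1] := leqP i 1; first by apply: near2_intro (walk_rcons wi uv) _ vD.
by apply: near2_intro wi i2 (uD _); lia.
Qed.

(** This can be had by symmetry: a counterexample [w] to the second alternative serves as [z] in the
    first after exchanging [p] and [q]. *)
Definition Q3_condition :=
  (exists z, [/\ dp z = 1, dq z = 2 & forall y, adj z y -> dp y <> dq y]) \/
  (forall w, dp w = 2 -> dq w = 1 -> exists2 y, adj w y & dp y = dq y).

(** In the first alternative a walk from [x] to [z] crosses to the side of [p]; crossing only at the
    fourth edge would give a triangle or a 4-cycle on [p q]. In the second, take the neighbour [w]
    of [q] on a shortest walk to [x]: the ranked walk [p z y w q] through its equidistant neighbour
    [y] puts it in the low core. *)
Lemma near2_Q3 x : Q3_condition -> dp x = 4 -> dq x = 3 -> near2 x.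
Proof.
move=> [[z [pz qz noM]]|haveM] px qx.
  have [k lek wk] := diam4 x z.
  have [||i [u [v [lti wi [nPu Pv] uv wv]]]] := walk_exit (X := [pred x | dq x <= dp x]) wk.
  - by rewrite /= px qx.
  - by rewrite /= pz qz.
  rewrite /= -ltnNge in nPu Pv; rewrite adj_sym in uv.
  have [ev ? ? ?] := cross_dist uv Pv nPu.
  have Hi := d_le p (walk_adj_sym wi); rewrite -/(dp x) -/(dp u) px in Hi.
  have [_ Hv _ _] := d_step uv.
  have [i3|i2] : i = 3 \/ i <= 2 by lia.
    have k4 : k - i.+1 = 0 by lia.
    move: wv; rewrite k4 => /eqP vz; rewrite vz in uv Pv Hv.
    have [? ? ? ?] := d_step uv; have ? := dp_le u; have := noM u uv => ?.
    have [qu|qu] : dq u = 0 \/ dq u = 1 by lia.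
      move: uv; rewrite (dq_eq0 qu) => zq; have := no_tri (dp_adj pz).
      by rewrite adj_sym zq.
    case: (no_sq (dp_adj pz) uv _); first by rewrite adj_sym dq_adj.
      by apply/eqP=> zq; rewrite zq dq_q in qz.
    by apply/eqP=> up; move: nPu; rewrite up dp_p dq_p.
  have ne : (v, u) != (p, q) by apply/eqP=> -[vp _]; move: Hv; rewrite vp dp_p; lia.
  by have [uD _] := low_core_cross uv ne Pv nPu; apply: near2_intro wi i2 uD.
have w3 := walk_adj_sym (d_walk q x); rewrite -/(dq x) qx -[3]/(2 + 1) in w3.
have [w wxw /= /existsP[t /andP[wq /eqP tq]]] := walk_split w3; rewrite tq in wq.
have [Hp _ Hq _] := d_step wq; rewrite dp_q in Hp; rewrite dq_q in Hq.
have Hw := d_le p (walk_adj_sym wxw); rewrite -/(dp w) -/(dp x) px in Hw.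
have Hw' := d_le q (walk_adj_sym wxw); rewrite -/(dq w) -/(dq x) qx in Hw'.
have [pw q1w] : dp w = 2 /\ dq w = 1 by lia.
have [y wy Ey] := haveM w pw q1w.
have [? ? ? ?] := d_step wy.
have y2 : dp y = 2.
  have [p1|//] : dp y = 1 \/ dp y = 2 by lia.
  by case: (no_M1 p1); rewrite -Ey.
have [_ [z rzy wz]] := low_core_M2 y2 (etrans (esym Ey) y2).
have ryw : rk y w.
  rewrite /rk adj_sym wy /= /rank pw q1w -Ey y2 /=.
  by apply/eqP=> -[yp _]; rewrite yp dp_p in y2.
have rwq : rk w q.
  rewrite /rk wq /= /rank pw q1w dp_q dq_q /=.
  by apply/eqP=> -[wp]; rewrite wp dp_p in pw.
apply: near2_intro wxw _ _ => //.
exact: low_core_walks (walk_rcons (walk_rcons wz rzy) ryw) (walk1 rwq) _ _.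
Qed.

Lemma near2_all x : Q3_condition -> near2 x.
Proof.
move=> cond; have [/near2_p //|p2] := leqP (dp x) 2.
have [/near2_q //|q2] := leqP (dq x) 2.
have [p4 q4] : dp x <= 4 /\ dq x <= 4 by split; apply: d_le4.
have [px|px] : dp x = 3 \/ dp x = 4 by lia.
  have [qx|qx] : dq x = 3 \/ dq x = 4 by lia.
    by have [i le [u uD w]] := low_core_M3 px qx; apply: near2_intro w (leqW le) uD.
  exact: near2_P3.
have [qx|qx] : dq x = 3 \/ dq x = 4 by lia.
  exact: near2_Q3.
(* Both distances are 4: the predecessor is within distance 1 of the low core, or its edge to [x]
   crosses. *)
have [z zx pz] := d_pred px; rewrite -/(dp z) in pz.
have [_ _ ? ?] := d_step zx; have ? := dq_le z.
have [qz|qz] : dq z = 3 \/ dq z = 4 by lia.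
  have [i le [u uD w]] := low_core_M3 pz qz; rewrite adj_sym in zx.
  by apply: near2_intro (walk_cons zx w) _ uD.
have ne : (z, x) != (p, q) by apply/eqP=> -[_ xq]; rewrite xq dq_q in qx.
have [xD _] : x \in low_core /\ (dq x <= 3 -> z \in low_core).
  by apply: low_core_cross => //; lia.
by apply: (@near2_intro 0 x x) => //=.
Qed.

Hypothesis sp : spans o D a b.
Hypothesis core_sum : forall x, x \in D -> a x + b x <= 8.

(** The whole graph is within distance 2 of the low core, so two rounds suffice: [ears_bridgeless]
    raises 4 to 8, and [last_step] ends at 10. *)
Lemma core_within_ten : Q3_condition -> within_ten.
Proof.
move=> cond.
have sD0 : low_core \subset D by apply/subsetP=> x; rewrite inE => /andP[].
have low0 u : u \in low_core -> a u <= 4 /\ b u <= 4.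
  by rewrite inE => /and3P[].
have low u : u \in D -> (a u <= 5) || (b u <= 5) by move/core_sum; lia.
have [|D1 [o1 [/subsetP sDD1 /subsetP sR sp1]]] := ears_bridgeless sp sD0 low0 low nobr.
  move=> x xD xR; have [[|[|[|//]]] _ [u uD w]] := near2_all x cond.
  - by move: xD; rewrite (eqP w) (subsetP sD0).
  - case/negP: xR; apply/rimP; split=> //; exists u; first exact: (subsetP sD0).
    by case/existsP: w => t /andP[xt /eqP <-]; rewrite adj_sym.
  rewrite -[2]/(1 + 1) in w.
  have [r /= /existsP[s /andP[xs /eqP sr]] /existsP[t /andP[rt /eqP tu]]] := walk_split w.
  rewrite sr in xs; rewrite tu adj_sym in rt; exists r => //.
  have rD : r \notin D.
    apply: contraNN xR => rD; apply/rimP; split=> //.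
    by exists r => //; rewrite adj_sym.
  by apply/rimP; split=> //; exists u.
have leD1 u : extend D a (4 + 4) u <= 8 /\ extend D b (4 + 4) u <= 8.
  by split; apply: extend_le => // /core_sum; lia.
apply: last_step sp1 (subxx D1) _ _ _ _ => [u _|u _|u _|x xD1].
- exact: leD1.
- by have [/leqW-> _] := leD1 u.
- by have [] := leD1 u; lia.
have [[|[|[|//]]] _ [u uD w]] := near2_all x cond.
- by case/negP: xD1; rewrite (eqP w); apply/sDD1/(subsetP sD0).
- exists u; first exact/sDD1/(subsetP sD0).
  by case/existsP: w => t /andP[xt /eqP <-]; rewrite adj_sym.
rewrite -[2]/(1 + 1) in w.
have [r /= /existsP[s /andP[xs /eqP sr]] /existsP[t /andP[rt /eqP tu]]] := walk_split w.
rewrite sr adj_sym in xs; rewrite tu adj_sym in rt; exists r => //.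
have [/sDD1 //|rD] := boolP (r \in D).
by apply/sR/rimP; split=> //; exists u.
Qed.

End NoSquare.

Lemma no_square_within_ten :
  (forall x y, adj p x -> adj x y -> adj y q -> x != q -> y != p -> False) ->
  Q3_condition -> within_ten.
Proof.
move=> no_sq cond; have [k0 le0 w0] := walk_pq.
(* The bound [k0 <= 8] fits [s = 4] and [kappa = 4]. *)
have [o [D [a [b [sp cw cs pqD low]]]]] := @rank_core 4 4 k0 isT w0 le0 (leqW le0).
exact: core_within_ten no_sq _ _ _ _ cw pqD low sp cs cond.
Qed.

(** * Every edge in a triangle or a 4-cycle *)

Section AllSquares.

Hypothesis squares : forall u v : G, adj u v ->
  (exists w, adj u w /\ adj v w) \/
  (exists w t, [/\ adj v w, adj w t, adj t u, w != u & t != v]).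

(** From weight 1 at [p] and [q], two rounds of [ears_square] give weights 4 and 7 and cover all
    vertices within distance 2 of [p] or [q]. Ears of increasing rank are then added, after which
    the vertices of weights at most 8 dominate the rest. *)
Lemma square_core_within_ten : within_ten.
Proof.
have [t [w [pt ptq tw ptw]]] : exists t w, [/\ adj t w, (t, w) != (p, q),
    dp t < dq t /\ dq w <= dp w & (dp t).+1 + dq w = 3].
  have [[z [/no_tri/negP no]]|[w [t [qw wt tp wp tq]]]] := squares pq; first by [].
  have [Hp1 _ Hq1 _] := d_step tp; rewrite dp_p dq_p in Hp1 Hq1.
  have qw' : adj w q by rewrite adj_sym.
  have [Hp2 _ Hq2 _] := d_step qw'; rewrite dp_q dq_q in Hp2 Hq2.
  have pt : dp t = 1.
    case E: (dp t) => [|k]; last lia.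
    by move: tp; rewrite (dp_eq0 E) adj_irrefl.
  have qw1 : dq w = 1.
    case E: (dq w) => [|k]; last lia.
    by move: qw; rewrite (dq_eq0 E) adj_irrefl.
  have qt : dq t = 2.
    case E: (dq t) => [|[|k]]; last lia.
      by move: tq; rewrite (dq_eq0 E) eqxx.
    by case: (no_M1 pt E).
  have pw : dp w = 2.
    case E: (dp w) => [|[|k]]; last lia.
      by move: wp; rewrite (dp_eq0 E) eqxx.
    by case: (no_M1 E qw1).
  exists t, w; rewrite adj_sym wt pt qt pw qw1; split=> //.
  by apply/eqP=> -[tE _]; rewrite tE dp_p in pt.
have [w1 _ _ w4] := cross_walks pt ptq tw.1 tw.2.
have w0 := walk_cat (walk_rcons w1 (rk_cross pt ptq tw.1 tw.2)) w4.
rewrite ptw in w0.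
(* The walk along the 4-cycle has length 3, which is at most [2 * s] for [s = 2] and equals
   [2 * kappa + 1] for [kappa = 1]. *)
have [o [D [a [b [sp cw cs [pD qD] low]]]]] := @rank_core 2 1 3 isT w0 isT isT.
have sD0 : [set p; q] \subset D by apply/subsetP=> x /set2P[]->.
have low0 u : u \in [set p; q] -> a u <= 1 /\ b u <= 1.
  by case: low => ? ? ? ?; case/set2P=> ->.
have lowD u : u \in D -> (a u <= 2) || (b u <= 2) by move/cs; lia.
have [|D1 [o1 [/subsetP sDD1 /subsetP sR1 sp1]]] := ears_square sp sD0 low0 lowD.
  by move=> u v _ _; apply: squares.
set a1 := extend D a _ in sp1; set b1 := extend D b _ in sp1.
have le1 u : u \in D1 -> a1 u <= 4 /\ b1 u <= 4.
  by move=> _; split; apply: extend_le => // /cs; lia.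
have low1 u : u \in D1 -> (a1 u <= 5) || (b1 u <= 5) by case/le1=> /leqW-> _.
have [|D2 [o2 [/subsetP sDD2 /subsetP sR2 sp2]]] := ears_square sp1 (subxx D1) le1 low1.
  by move=> u v _ _; apply: squares.
set a2 := extend D1 a1 _ in sp2; set b2 := extend D1 b1 _ in sp2.
have le2 u : a2 u <= 7 /\ b2 u <= 7.
  by split; apply: extend_le => // uD1; have [? ?] := le1 u uD1; lia.
have nbr1 x u : u \in [set p; q] -> adj u x -> x \in D1.
  move=> uD0 ux; have [/sDD1 //|xD] := boolP (x \in D).
  by apply/sR1/rimP; split=> //; exists u.
have nbr2 x u : u \in D1 -> adj u x -> x \in D2.
  move=> uD0 ux; have [/sDD2 //|xD] := boolP (x \in D1).
  by apply/sR2/rimP; split=> //; exists u.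
have pD1 : p \in D1 by apply: sDD1.
have qD1 : q \in D1 by apply: sDD1.
have p2 x : dp x <= 2 -> x \in D2.
  case E: (dp x) => [|k]; first by rewrite (dp_eq0 E) => _; apply: sDD2.
  have [z zx Ez] := d_pred E; rewrite -/(dp z) in Ez => lek.
  apply: nbr2 zx; case: k lek E Ez => [|[|//]] _ _ Ez; first by rewrite (dp_eq0 Ez).
  by apply: nbr1 (set21 p q) _; apply: dp_adj.
have q2 x : dq x <= 2 -> x \in D2.
  case E: (dq x) => [|k]; first by rewrite (dq_eq0 E) => _; apply: sDD2.
  have [z zx Ez] := d_pred E; rewrite -/(dq z) in Ez => lek.
  apply: nbr2 zx; case: k lek E Ez => [|[|//]] _ _ Ez; first by rewrite (dq_eq0 Ez).
  by apply: nbr1 (set22 p q) _; apply: dq_adj.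
(* A ranked walk of length [2 + 2] from [p] to [q] passes through [x], so the core contains it, and
   [D2] its neighbours. *)
have M2D x : dp x = 2 -> dq x = 2 -> x \in D1.
  move=> px qx; apply: sDD1.
  have [|z [zx pz [qz|qz]]] := d_pred_edge pq px; first by rewrite -/(dp x) -/(dq x) px qx.
    by case: (no_M1 pz qz).
  rewrite -/(dp z) in pz; rewrite -/(dq z) in qz.
  have ne : (z, x) != (p, q) by apply/eqP=> -[_ xq]; rewrite xq dq_q in qx.
  have lt : dp z < dq z by rewrite pz qz.
  have le : dq x <= dp x by rewrite px qx.
  have [_ _ wx wx'] := cross_walks zx ne lt le.
  by have [] := cw x _ _ wx wx'; rewrite ?pz ?qx.
have le4 x : dp x <= 4 /\ dq x <= 4 by split; apply: d_le4.
have lt2_le4 i : 2 < i -> i <= 4 -> i = 3 \/ i = 4.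
  by case: i => [|[|[|[|[|i]]]]] // _ _; [left | right].
have qp : adj q p by rewrite adj_sym.
pose M3 x := (dp x == 3) && (dq x == 3).
pose P3 x := (dp x == 3) && (dq x == 4).
pose Q3 x := (dp x == 4) && (dq x == 3).
(* Such vertices lie on ears from [D2] through [P3], [Y] and [Q3] back to [D2]; a vertex of [M3]
   outside [D2] forms an ear of length 2. *)
pose Y x := [&& dp x == 4, dq x == 4, [exists y, adj x y && P3 y]
  & [exists y, adj x y && Q3 y]].
pose X := [set x | [|| M3 x, Y x, P3 x && [exists y, adj x y && Y y]
  | Q3 x && [exists y, adj x y && Y y]]].
pose D3 := D2 :|: X.
(* Starting from 7 on [D2], costs along such an ear are 8, 9, 10: forwards for [a3], backwards for
   [b3]. *)
pose a3 x := if x \in D2 then a2 x else if dp x == 3 then 8 else if dq x == 4 then 9 else 10.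
pose b3 x := if x \in D2 then b2 x else if dq x == 3 then 8 else if dp x == 4 then 9 else 10.
pose n : rel G := fun x y =>
  [&& adj x y, rank x < rank y & ~~ ((x \in D2) && (y \in D2))].
pose n' := [rel x y | [&& n x y, x \in D3 & y \in D3]].
pose from k v := exists c i, [/\ c \in D2, walk n' i c v & a2 c + i <= k].
pose to k v := exists c i, [/\ c \in D2, walk n' i v c & b2 c + i <= k].
have from0 k v : 7 <= k -> v \in D2 -> from k v.
  by move=> le7 vD; exists v, 0; split; rewrite //= addn0 (leq_trans (le2 v).1).
have to0 k v : 7 <= k -> v \in D2 -> to k v.
  by move=> le7 vD; exists v, 0; split; rewrite //= addn0 (leq_trans (le2 v).2).
have fromS k u v : 7 <= k -> from k u -> u \in D3 -> v \in D3 -> adj u v ->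
    rank u < rank v -> from k.+1 v.
  move=> le7 [c [i [cD wi lei]]] uD vD uv lt; have [vD2|vD2] := boolP (v \in D2).
    by apply: from0 => //; apply: leqW.
  exists c, i.+1; split=> //; last by rewrite addnS ltnS.
  by apply: walk_rcons wi _; rewrite /= /n uv lt (negPf vD2) andbF uD vD.
have toS k u v : 7 <= k -> to k v -> u \in D3 -> v \in D3 -> adj u v ->
    rank u < rank v -> to k.+1 u.
  move=> le7 [c [i [cD wi lei]]] uD vD uv lt; have [uD2|uD2] := boolP (u \in D2).
    by apply: to0 => //; apply: leqW.
  exists c, i.+1; split=> //; last by rewrite addnS ltnS.
  by apply: walk_cons wi; rewrite /= /n uv lt (negPf uD2) uD vD.
have sD23 x : x \in D2 -> x \in D3 by move=> xD; apply/setUP; left.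
have inX x : x \in D3 -> x \notin D2 -> x \in X by case/setUP=> // ->.
have sX3 x : x \in X -> x \in D3 by move=> xX; apply/setUP; right.
have rkM x : dp x = dq x -> rank x = 10 - dp x by move=> E; rewrite /rank E ltnn eqxx.
have rkP x : dp x < dq x -> rank x = dp x by move=> lt; rewrite /rank lt.
have rkQ x : dq x < dp x -> rank x = 20 - dq x.
  by move=> lt; rewrite /rank ltnNge (ltnW lt) /= gtn_eqF.
(* A predecessor at distance 2 from both [p] and [q] would put [x] in [D2], so the predecessor is on
   the side of [p]. *)
have predP x : x \notin D2 -> dp x = 3 ->
    exists y, [/\ adj y x, y \in D2 & rank y = 2].
  move=> xD px; have lt2 : 2 < dq x by rewrite ltnNge; apply: contraNN xD => /q2.
  have [|y [yx py qy]] := d_pred_edge pq px; first by rewrite -/(dp x) -/(dq x) px.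
  have [qy2|qy3] := qy; first by case/negP: xD; apply: nbr2 yx; apply: M2D.
  exists y; split=> //; first by apply: p2; rewrite /dp py.
  by rewrite rkP /dp /dq py // qy3.
have predQ x : x \notin D2 -> dq x = 3 ->
    exists y, [/\ adj x y, y \in D2 & rank y = 18].
  move=> xD qx; have lt2 : 2 < dp x by rewrite ltnNge; apply: contraNN xD => /p2.
  have [|y [yx qy py]] := d_pred_edge qp qx; first by rewrite -/(dp x) -/(dq x) qx.
  have [py2|py3] := py; first by case/negP: xD; apply: nbr2 yx; apply: M2D.
  exists y; rewrite adj_sym yx; split=> //; first by apply: q2; rewrite /dq qy.
  by rewrite rkQ /dp /dq qy // py3.
have YX x : Y x -> x \in D3 by move=> Yx; apply: sX3; rewrite inE Yx orbT.
have P3X x y : P3 x -> adj x y -> Y y -> x \in D3.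
  move=> Px xy Yy; apply: sX3; rewrite inE Px; apply/or4P/Or43.
  by apply/existsP; exists y; rewrite xy.
have Q3X x y : Q3 x -> adj x y -> Y y -> x \in D3.
  move=> Qx xy Yy; apply: sX3; rewrite inE Qx; apply/or4P/Or44.
  by apply/existsP; exists y; rewrite xy.
have fromP x : dp x = 3 -> rank x > 2 -> x \in D3 -> from 8 x.
  move=> px rx xD3; have [xD|xD] := boolP (x \in D2); first exact: from0.
  have [y [yx yD ry]] := predP x xD px.
  by apply: fromS (from0 7 y _ yD) (sD23 y yD) xD3 yx _; rewrite ?ry.
have toQ x : dq x = 3 -> rank x < 18 -> x \in D3 -> to 8 x.
  move=> qx rx xD3; have [xD|xD] := boolP (x \in D2); first exact: to0.
  have [y [xy yD ry]] := predQ x xD qx.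
  by apply: toS (to0 7 y _ yD) xD3 (sD23 y yD) xy _; rewrite ?ry.
have rP3 x : P3 x -> rank x = 3 by case/andP=> /eqP px /eqP qx; rewrite rkP px ?qx.
have rQ3 x : Q3 x -> rank x = 17 by case/andP=> /eqP px /eqP qx; rewrite rkQ qx ?px.
have rY x : Y x -> rank x = 6 by case/and4P=> /eqP px /eqP qx _ _; rewrite rkM px ?qx.
have rM3 x : M3 x -> rank x = 7 by case/andP=> /eqP px /eqP qx; rewrite rkM px ?qx.
have fromY x : Y x -> from 9 x.
  move=> Yx; have /and4P[_ _ /existsP[y /andP[xy Py]] _] := Yx.
  rewrite adj_sym in xy; have yD := P3X y x Py xy Yx.
  apply: fromS (fromP y _ _ yD) yD (YX x Yx) xy _ => //; rewrite ?(rP3 y Py) ?(rY x Yx) //.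
  by case/andP: Py => /eqP.
have toY x : Y x -> to 9 x.
  move=> Yx; have /and4P[_ _ _ /existsP[y /andP[xy Qy]]] := Yx.
  have yx := xy; rewrite adj_sym in yx; have yD := Q3X y x Qy yx Yx.
  apply: toS (toQ y _ _ yD) (YX x Yx) yD xy _ => //; rewrite ?(rQ3 y Qy) ?(rY x Yx) //.
  by case/andP: Qy => _ /eqP.
have [o3 sp3] : exists o3, spans o3 D3 a3 b3.
  apply: (grow (n := n) sp2).
  - exact: subsetUl.
  - by move=> x y /and3P[].
  - by move=> x y /and3P[_ lt _]; apply/negP=> /and3P[_]; rewrite ltnNge (ltnW lt).
  - by move=> x y /and3P[].
  - by move=> x xD; rewrite /a3 xD.
  - by move=> x xD; rewrite /b3 xD.
  - move=> v vD3 vD2; rewrite /a3 (negPf vD2); move: (inX v vD3 vD2).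
    rewrite inE => /or4P[Mv|Yv|/andP[Pv _]|/andP[Qv /existsP[y /andP[vy Yy]]]].
    + have /andP[/eqP pv _] := Mv; rewrite pv eqxx; apply: (fromP v) => //.
      by rewrite rM3.
    + by have /and4P[/eqP-> -> _ _] := Yv; apply: fromY.
    + have /andP[/eqP pv _] := Pv; rewrite pv eqxx; apply: (fromP v) => //.
      by rewrite rP3.
    have /andP[/eqP-> /eqP->] := Qv; rewrite /=.
    rewrite adj_sym in vy.
    by apply: fromS (fromY y Yy) (YX y Yy) vD3 vy _; rewrite // (rY y Yy) (rQ3 v Qv).
  move=> v vD3 vD2; rewrite /b3 (negPf vD2); move: (inX v vD3 vD2).
  rewrite inE => /or4P[Mv|Yv|/andP[Pv /existsP[y /andP[vy Yy]]]|/andP[Qv _]].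
  + have /andP[_ /eqP qv] := Mv; rewrite qv eqxx; apply: (toQ v) => //.
    by rewrite rM3.
  + by have /and4P[-> /eqP-> _ _] := Yv; apply: toY.
  + have /andP[/eqP-> /eqP->] := Pv; rewrite /=.
    by apply: toS (toY y Yy) vD3 (YX y Yy) vy _; rewrite // (rY y Yy) (rP3 v Pv).
  have /andP[_ /eqP qv] := Qv; rewrite qv eqxx; apply: (toQ v) => //.
  by rewrite rQ3.
(* This set consists of [D2] and [M3]. *)
pose D0 := [set x in D3 | (a3 x <= 8) && (b3 x <= 8)].
have D2D0 x : x \in D2 -> x \in D0.
  move=> xD; rewrite inE sD23 // /a3 /b3 xD.
  by have [/leqW-> /leqW->] := le2 x.
have M3D0 x : M3 x -> x \in D0.
  move=> Mx; have [/D2D0 //|xD] := boolP (x \in D2).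
  rewrite inE /a3 /b3 (negPf xD) sX3 ?inE ?Mx //.
  by have /andP[-> ->] := Mx.
have le10 u : a3 u <= 10 /\ b3 u <= 10.
  rewrite /a3 /b3; have [lea leb] := le2 u.
  by split; do ?case: ifP => // _; [apply: leq_trans lea _ | apply: leq_trans leb _].
apply: last_step sp3 (_ : D0 \subset D3) _ _ _ _.
- by apply/subsetP=> x; rewrite inE => /andP[].
- by move=> x; rewrite inE => /and3P[].
- move=> x xD3; have [xD|xD] := boolP (x \in D2).
    by rewrite /a3 xD (leq_trans (le2 x).1).
  move: (inX x xD3 xD).
  rewrite /a3 /b3 (negPf xD) inE.
  case/or4P=> [/andP[-> _]|/and4P[_ -> _ _]|/andP[/andP[-> _] _]|/andP[/andP[_ ->] _]] //.
    by case: ifP.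
  by rewrite orbT.
- by move=> x _; apply: le10.
(* A vertex outside [D3] at distance 3 from [p] or [q] has a neighbour in [D2]. At distance 4 from
   both it has one in [M3], or else one in [P3] and one in [Q3], and then it would satisfy [Y]. *)
move=> x; rewrite in_setU negb_or => /andP[xD2 xX].
have p3 : 2 < dp x by rewrite ltnNge; apply: contraNN xD2 => /p2.
have q3 : 2 < dq x by rewrite ltnNge; apply: contraNN xD2 => /q2.
have [lep leq] := le4 x.
have [px|px] := lt2_le4 _ p3 lep.
  by have [y [yx yD _]] := predP x xD2 px; exists y => //; apply: D2D0.
have [qx|qx] := lt2_le4 _ q3 leq.
  have [y [xy yD _]] := predQ x xD2 qx; exists y; first exact: D2D0.
  by rewrite adj_sym.
have [|y [yx py [qy|qy]]] := d_pred_edge pq px; first by rewrite -/(dp x) -/(dq x) px qx.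
  by exists y => //; apply: M3D0; rewrite /M3 /dp /dq py qy.
have [|z [zx qz [pz|pz]]] := d_pred_edge qp qx; first by rewrite -/(dp x) -/(dq x) qx px.
  by exists z => //; apply: M3D0; rewrite /M3 /dp /dq pz qz.
case/negP: xX; rewrite inE; apply/or4P/Or42; rewrite /Y px qx /=.
apply/andP; split; apply/existsP.
  by exists y; rewrite adj_sym yx /P3 /dp /dq py qy.
by exists z; rewrite adj_sym zx /Q3 /dp /dq pz qz.
Qed.

End AllSquares.

End RankCore.
End DiameterFour.

(** * Choice of the edge [p q] and conclusion *)

Lemma diameter_four_within_ten (G : sgraph) :
  two_edge_connected G -> is_diameter (@adj G) 4 -> within_ten G.
Proof.
move=> ec [[x0 [_ _]] diam]; have nobr := bridgeless_connect ec.
have diam4 (x y : G) : exists2 k, k <= 4 & walk (@adj G) k x y.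
  have [k [[p pxy Ep] _] le] := diam x y; exists k => //.
  by rewrite -Ep; apply: dipath_walk.
pose tri (u v : G) := [exists w, adj u w && adj v w].
pose square (u v : G) := [exists w, exists t,
  [&& adj v w, adj w t, adj t u, w != u & t != v]].
have [/forallP all_tri|] := boolP [forall u, forall v, adj u v ==> tri u v].
  apply: all_triangles x0 _ => // u v uv.
  have /forallP/(_ v)/implyP/(_ uv)/existsP[w /andP[uw vw]] := all_tri u.
  by exists w.
rewrite negb_forall => /existsP[p0]; rewrite negb_forall => /existsP[q0].
rewrite negb_imply => /andP[pq0 ntri0].
have [/forallP all_sq|] :=
    boolP [forall u, forall v, adj u v ==> (tri u v || square u v)].
  apply: (@square_core_within_ten G nobr diam4 p0 q0 pq0).
    move=> z pz; apply: contraNN ntri0 => qz.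
    by apply/existsP; exists z; rewrite pz.
  move=> u v uv; have /forallP/(_ v)/implyP/(_ uv)/orP[] := all_sq u.
    by case/existsP=> w /andP[uw vw]; left; exists w.
  by case/existsP=> w /existsP[t /and5P[? ? ? ? ?]]; right; exists w, t.
rewrite negb_forall => /existsP[p]; rewrite negb_forall => /existsP[q].
rewrite negb_imply negb_or => /and3P[pq ntri nsq].
have no_tri z : adj p z -> ~~ adj q z.
  by move=> pz; apply: contraNN ntri => qz; apply/existsP; exists z; rewrite pz.
have no_sq x y : adj p x -> adj x y -> adj y q -> x != q -> y != p -> False.
  move=> px xy yq xNq yNp; case/negP: nsq; apply/existsP; exists y; apply/existsP.
  by exists x; rewrite adj_sym yq adj_sym xy adj_sym px yNp xNq.
have qp : adj q p by rewrite adj_sym.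
have no_tri' z : adj q z -> ~~ adj p z.
  by move=> qz; apply/negP=> /no_tri; rewrite qz.
have no_sq' x y : adj q x -> adj x y -> adj y p -> x != p -> y != q -> False.
  move=> qx xy yp xp yq; apply: (no_sq y x) => //; by rewrite adj_sym.
pose dp := dist (@adj G) p; pose dq := dist (@adj G) q.
have [/forallP haveM|] := boolP [forall w, ((dp w == 2) && (dq w == 1)) ==>
    [exists y, adj w y && (dp y == dq y)]].
  apply: (no_square_within_ten nobr diam4 pq no_tri no_sq); right=> w pw qw.
  have := haveM w; rewrite /dp /dq pw qw => /existsP[y /andP[wy /eqP Ey]].
  by exists y.
rewrite negb_forall => /existsP[w]; rewrite negb_imply => /andP[/andP[/eqP pw /eqP qw]].
rewrite negb_exists => /forallP noM.
apply: (no_square_within_ten nobr diam4 qp no_tri' no_sq'); left.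
exists w; split=> // y wy Ey; have := noM y.
by rewrite wy /dp /dq Ey eqxx.
Qed.

Theorem theorem5 :
  (exists2 m : nat, is_f 4 m & m <= 21) /\
  (forall G : sgraph, two_edge_connected G -> is_diameter (@adj G) 4 ->
     exists o : rel G,
       [/\ orientation o, strongly_connected o
         & exists2 k : nat, is_diameter o k & k <= 21]).
Proof.
have main (G : sgraph) : two_edge_connected G -> is_diameter (@adj G) 4 ->
     exists o : rel G,
       [/\ orientation o, strongly_connected o
         & exists2 k : nat, is_diameter o k & k <= 21].
  move=> ec diam; have [o [a [b [sp le]]]] := diameter_four_within_ten ec diam.
  by have [[x0 _] _] := diam; apply: spans_orientation x0 sp le.
by split=> //; apply: is_f_bound.
Qed.
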